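(* Let $b\in\mathbb{C}$. The exceptional Krall polynomials satisfy $$\frac1{\sqrt\pi}\int_{-\infty}^\infty \tilde h_{n+1}(x;b)\,\tilde h_{m+1}(x;b)\,\frac{e^{-x^2}}{(x+b)^2}\,dx=\delta_{mn}\,p_2(-2n)\,\nu_n,\qquad m,n=0,1,2,\dots,$$ where the integral is taken along any contour from $-\infty$ to $+\infty$ that avoids the singularity at $x=-b$. Equivalently, with the same meaning of the integral, $$\frac1{\sqrt\pi}\int_{-\infty}^\infty \hat h_n(x;b)\,\hat h_m(x;b)\,e^{-x^2}\,dx=\delta_{mn}\,p_2(-2n)\,\nu_n,\qquad m,n=0,1,2,\dots$$
   Context: $h_n(x)=\sum_{j=0}^{\lfloor n/2\rfloor}\frac{n!}{(n-2j)!\,j!}x^{n-2j}(-4)^{-j}$, $n\in\mathbb{N}_0$, are the monic Hermite polynomials. For $n\in\mathbb{N}_0$, $$\hat h_n(x;b)=(b^2-2n)h_n(x)-\frac{b\,h_n(x)+n\,h_{n-1}(x)}{x+b},\qquad \tilde h_{n+1}(x;b)=(x+b)\hat h_n(x;b),$$ where $n\,h_{n-1}$ is $0$ when $n=0$. Further, $\nu_n=2^{-n}n!$ and $p_2(T)=(T+b^2)(T+b^2-2)$, so $p_2(-2n)=(b^2-2n)(b^2-2n-2)$. *)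

(* Defs.v *)
From Stdlib Require Import Arith Reals List.
From Coquelicot Require Import Coquelicot.

Open Scope R_scope.
Open Scope C_scope.

Definition Cexp (z : C) : C :=
  ((exp (Re z) * cos (Im z))%R, (exp (Re z) * sin (Im z))%R).

(* Junk value at points where [g] is not differentiable; such points are
   locally finite for the paths considered below. *)
Definition path_derive (g : R -> C) (t : R) : C :=
  (Derive (fun s => Re (g s)) t, Derive (fun s => Im (g s)) t).

(* Piecewise C^1 on every bounded interval, with finite one-sided limits of the
   derivative everywhere; breakpoints may accumulate only at infinity. *)
Definition piecewise_C1 (g : R -> C) : Prop :=
  (forall t : R, continuous g t) /\
  (forall u v : R, exists l : list R, forall t : R,
      (u < t < v)%R -> ~ In t l ->
      ex_derive (V := C_R_NormedModule) g t /\ continuous (path_derive g) t) /\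
  (forall t : R,
      (exists d : C, filterlim (path_derive g) (at_left t) (locally d)) /\
      (exists d : C, filterlim (path_derive g) (at_right t) (locally d))).

(* The ends -oo and +oo are those of the real axis: the real part diverges and
   the path is asymptotically horizontal (arg g -> pi, resp. arg g -> 0). This
   includes every path with bounded imaginary part, in particular those which
   agree with the real axis outside a compact set. *)
Definition contour_minfty_pinfty (g : R -> C) : Prop :=
  piecewise_C1 g /\
  is_lim (fun t => Re (g t)) m_infty m_infty /\
  is_lim (fun t => (Im (g t) / Re (g t))%R) m_infty 0%R /\
  is_lim (fun t => Re (g t)) p_infty p_infty /\
  is_lim (fun t => (Im (g t) / Re (g t))%R) p_infty 0%R.

(* Improper integral of f(z) dz along the whole path: convergence, the two ends
   going to infinity independently, with value [I]. *)
Definition is_contour_integral (g : R -> C) (f : C -> C) (I : C) : Prop :=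
  is_RInt_gen (V := C_R_NormedModule)
    (fun t => f (g t) * path_derive g t)
    (Rbar_locally m_infty) (Rbar_locally p_infty) I.

Definition hermite (n : nat) (x : C) : C :=
  sum_n (fun j : nat =>
    RtoC (INR (fact n) / (INR (fact (n - 2 * j)) * INR (fact j)))
    * x ^ (n - 2 * j) * / (RtoC (-4) ^ j)) (n / 2).

(* For n = 0 the term INR n * hermite (n - 1) is 0. *)
Definition hhat (n : nat) (b x : C) : C :=
  (b ^ 2 - 2 * INR n) * hermite n x
  - (b * hermite n x + INR n * hermite (n - 1) x) / (x + b).

(* [htildeS n] is the polynomial of index n + 1; there is none of index 0. *)
Definition htildeS (n : nat) (b x : C) : C := (x + b) * hhat n b x.

Definition nu (n : nat) : R := (/ 2 ^ n * INR (fact n))%R.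

Definition p2 (b T : C) : C := (T + b ^ 2) * (T + b ^ 2 - 2).

Definition kronecker (m n : nat) : C := if Nat.eqb m n then 1 else 0.

(* Main.v *)
Require Import Defs.
From Stdlib Require Import Arith Reals Lra Lia List.
From Coquelicot Require Import Coquelicot.
Open Scope R_scope.
Open Scope C_scope.

(** Write [w = exp (- x^2)], [s = x + b], [y = h_n], [z = h_m], [Y = b y + y'],
    [Z = b z + z'], where [y'' = 2 x y' - 2 n y].  Since
    [Y' = - b Y + (b^2 - 2 n) y + 2 s y'], the poles of the integrand are exact:
    [hhat_n hhat_m w = (- Y Z w / s + 2 y z' w)' + c y z w] with
    [c = (b^2 - 2 n) (b^2 - 2 m) + 4 m - 2 b^2], which is [p2 (- 2 n)] for [m = n].
    For [m <> n], [(2 m - 2 n) y z w = (w (y' z - y z'))']; for [m = n],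
    [h_{n+1}^2 w = (n + 1) / 2 h_n^2 w - (h_{n+1} h_n w)' / 2] reduces the norm to
    the integral of [exp (- z^2)].  Everything therefore has a primitive without
    residues along the path, all Gaussian boundary terms vanish at the ends, and
    the only surviving value is the one of the entire primitive of [exp (- z^2)],
    whose limits at the two ends are [-sqrt PI / 2] and [sqrt PI / 2]. *)

(** * Calculus along a path *)

(** The contour may wind around [- b] in any way; a primitive that is single-valued off [- b] makes
    its value depend on the two ends alone, so neither homotopy nor residue calculus enters. The
    simple pole cancels for this reason: in [- (Y Z w / s)'] the weight contributes [2 x Y Z w / s],
    the terms [- b Y] and [- b Z] of [Y'] and [Z'] contribute [2 b Y Z w / s], and the sum is
    [2 Y Z w]. The terms [(b^2 - 2 n) y] and [(b^2 - 2 m) z] reproduce the mixed terms of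
    [hhat_n hhat_m]. The rest of [- (Y Z w / s)'] is [2 (b^2 y z - y' z') w], and
    [y' z' w = (y z' w)' + 2 m y z w] by the equation of [z]: hence [4 m - 2 b^2] in [c]. At the
    ends the imaginary part may be unbounded, while [exp (- z^2)] has modulus [exp (Im^2 - Re^2)];
    the decay therefore rests on the asymptotically horizontal direction of the path. *)

Lemma C_eq (z w : C) : Re z = Re w -> Im z = Im w -> z = w.
Proof. destruct z, w; simpl; intros; subst; reflexivity. Qed.

(** Componentwise, so that real calculus does the work; a holomorphic function enters only through
    its composite with a path, never through a complex derivative. *)
Definition is_path_derive (G : R -> C) (t : R) (d : C) : Prop :=
  is_derive (fun s => Re (G s)) t (Re d) /\
  is_derive (fun s => Im (G s)) t (Im d).

Definition path_continuous (G : R -> C) (t : R) : Prop :=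
  continuous (fun s => Re (G s)) t /\ continuous (fun s => Im (G s)) t.

Lemma is_path_derive_eq (G : R -> C) (t : R) (d d' : C) :
  d = d' -> is_path_derive G t d -> is_path_derive G t d'.
Proof. now intros ->. Qed.

Lemma is_path_derive_ext (G H : R -> C) (t : R) (d : C) :
  (forall s, G s = H s) -> is_path_derive G t d -> is_path_derive H t d.
Proof.
  intros E [H1 H2]; split.
  - apply (is_derive_ext (fun s => Re (G s))); [now intros; rewrite E | exact H1].
  - apply (is_derive_ext (fun s => Im (G s))); [now intros; rewrite E | exact H2].
Qed.

Lemma is_path_derive_const (c : C) (t : R) : is_path_derive (fun _ => c) t 0.
Proof. split; apply @is_derive_const. Qed.

Lemma is_path_derive_plus (G H : R -> C) (t : R) (d e : C) :
  is_path_derive G t d -> is_path_derive H t e ->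
  is_path_derive (fun s => G s + H s) t (d + e).
Proof.
  intros [G1 G2] [H1 H2]; split.
  - exact (is_derive_plus _ _ _ _ _ G1 H1).
  - exact (is_derive_plus _ _ _ _ _ G2 H2).
Qed.

Lemma is_path_derive_mult (G H : R -> C) (t : R) (d e : C) :
  is_path_derive G t d -> is_path_derive H t e ->
  is_path_derive (fun s => G s * H s) t (d * H t + G t * e).
Proof.
  unfold is_path_derive.
  set (u := fun s => Re (G s)); set (v := fun s => Im (G s)).
  set (p := fun s => Re (H s)); set (q := fun s => Im (H s)).
  intros [G1 G2] [H1 H2]; split.
  - change (is_derive (fun s => u s * p s - v s * q s)%R t
      (Re d * p t - Im d * q t + (u t * Re e - v t * Im e))%R).
    auto_derive; repeat split; try (now eexists; eauto).
    rewrite (is_derive_unique (fun s : R => u s) _ _ G1), (is_derive_unique (fun s : R => v s) _ _ G2),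
      (is_derive_unique (fun s : R => p s) _ _ H1), (is_derive_unique (fun s : R => q s) _ _ H2); ring.
  - change (is_derive (fun s => u s * q s + v s * p s)%R t
      (Re d * q t + Im d * p t + (u t * Im e + v t * Re e))%R).
    auto_derive; repeat split; try (now eexists; eauto).
    rewrite (is_derive_unique (fun s : R => u s) _ _ G1), (is_derive_unique (fun s : R => v s) _ _ G2),
      (is_derive_unique (fun s : R => p s) _ _ H1), (is_derive_unique (fun s : R => q s) _ _ H2); ring.
Qed.

Lemma C_norm2_neq_0 (z : C) : z <> 0 -> (Re z ^ 2 + Im z ^ 2 <> 0)%R.
Proof.
  intros Hz E; apply Hz; apply C_eq; simpl; nra.
Qed.

Lemma is_path_derive_inv (G : R -> C) (t : R) (d : C) :
  is_path_derive G t d -> G t <> 0 ->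
  is_path_derive (fun s => / G s) t (- (d / (G t * G t))).
Proof.
  intros HG Hz; apply C_norm2_neq_0 in Hz; revert HG.
  unfold is_path_derive.
  (* With [z = G t], this is [- d * conj(z)^2 / |z|^4] in real coordinates, the form in which the
     real derivatives of [Re z / |z|^2] and [- Im z / |z|^2] appear. *)
  assert (E : - (d / (G t * G t)) =
    ((- (Re d * (Re (G t) ^ 2 - Im (G t) ^ 2) + 2 * Im d * Re (G t) * Im (G t))
       / (Re (G t) ^ 2 + Im (G t) ^ 2) ^ 2)%R,
     (- (Im d * (Re (G t) ^ 2 - Im (G t) ^ 2) - 2 * Re d * Re (G t) * Im (G t))
       / (Re (G t) ^ 2 + Im (G t) ^ 2) ^ 2)%R)).
  { destruct (G t) as [x y]; unfold Re, Im in Hz; simpl in Hz.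
    apply C_eq; unfold Cdiv, Cinv, Cmult, Copp, Re, Im; simpl; field;
      (split; [nra |]);
      replace ((x * x - y * y) * (x * x - y * y) + (x * y + y * x) * (x * y + y * x))%R
        with ((x * (x * 1) + y * (y * 1)) * (x * (x * 1) + y * (y * 1)))%R by ring;
      nra. }
  rewrite E; clear E; unfold Cinv; simpl fst; simpl snd.
  set (u := fun s => Re (G s)); set (v := fun s => Im (G s)).
  change (Re (G t)) with (u t) in *; change (Im (G t)) with (v t) in *.
  intros [G1 G2]; split.
  - change (is_derive (fun s => u s / (u s ^ 2 + v s ^ 2))%R t
      (- (Re d * (u t ^ 2 - v t ^ 2) + 2 * Im d * u t * v t)
         / (u t ^ 2 + v t ^ 2) ^ 2)%R).
    auto_derive; repeat split; try (now eexists; eauto); try (simpl in Hz; exact Hz).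
    rewrite (is_derive_unique (fun s : R => u s) _ _ G1), (is_derive_unique (fun s : R => v s) _ _ G2).
    field; simpl in Hz; nra.
  - change (is_derive (fun s => - v s / (u s ^ 2 + v s ^ 2))%R t
      (- (Im d * (u t ^ 2 - v t ^ 2) - 2 * Re d * u t * v t)
         / (u t ^ 2 + v t ^ 2) ^ 2)%R).
    auto_derive; repeat split; try (now eexists; eauto); try (simpl in Hz; exact Hz).
    rewrite (is_derive_unique (fun s : R => u s) _ _ G1), (is_derive_unique (fun s : R => v s) _ _ G2).
    field; simpl in Hz; nra.
Qed.

Lemma is_path_derive_Cexp (G : R -> C) (t : R) (d : C) :
  is_path_derive G t d ->
  is_path_derive (fun s => Cexp (G s)) t (Cexp (G t) * d).
Proof.
  unfold is_path_derive.
  set (u := fun s => Re (G s)); set (v := fun s => Im (G s)).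
  intros [G1 G2]; split.
  - change (is_derive (fun s => exp (u s) * cos (v s))%R t
      (exp (u t) * cos (v t) * Re d - exp (u t) * sin (v t) * Im d)%R).
    auto_derive; repeat split; try (now eexists; eauto).
    rewrite (is_derive_unique (fun s : R => u s) _ _ G1), (is_derive_unique (fun s : R => v s) _ _ G2); ring.
  - change (is_derive (fun s => exp (u s) * sin (v s))%R t
      (exp (u t) * cos (v t) * Im d + exp (u t) * sin (v t) * Re d)%R).
    auto_derive; repeat split; try (now eexists; eauto).
    rewrite (is_derive_unique (fun s : R => u s) _ _ G1), (is_derive_unique (fun s : R => v s) _ _ G2); ring.
Qed.

Lemma path_continuous_ext (G H : R -> C) (t : R) :
  (forall s, G s = H s) -> path_continuous G t -> path_continuous H t.
Proof.
  intros E [H1 H2]; split.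
  - apply (continuous_ext (fun s => Re (G s))); [now intros; rewrite E | exact H1].
  - apply (continuous_ext (fun s => Im (G s))); [now intros; rewrite E | exact H2].
Qed.

Lemma path_continuous_const (c : C) (t : R) : path_continuous (fun _ => c) t.
Proof. split; apply continuous_const. Qed.

Lemma path_continuous_plus (G H : R -> C) (t : R) :
  path_continuous G t -> path_continuous H t ->
  path_continuous (fun s => G s + H s) t.
Proof.
  intros [G1 G2] [H1 H2]; split; simpl.
  - exact (continuous_plus _ _ _ G1 H1).
  - exact (continuous_plus _ _ _ G2 H2).
Qed.

Lemma path_continuous_mult (G H : R -> C) (t : R) :
  path_continuous G t -> path_continuous H t ->
  path_continuous (fun s => G s * H s) t.
Proof.
  intros [G1 G2] [H1 H2]; split; simpl.
  - exact (continuous_minus _ _ _ (continuous_mult _ _ _ G1 H1)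
             (continuous_mult _ _ _ G2 H2)).
  - exact (continuous_plus _ _ _ (continuous_mult _ _ _ G1 H2)
             (continuous_mult _ _ _ G2 H1)).
Qed.

Lemma path_continuous_inv (G : R -> C) (t : R) :
  path_continuous G t -> G t <> 0 -> path_continuous (fun s => / G s) t.
Proof.
  intros [G1 G2] Hz; apply C_norm2_neq_0 in Hz.
  assert (N : continuous (fun s => (/ (Re (G s) ^ 2 + Im (G s) ^ 2))%R) t).
  { apply (continuous_comp (fun s => Re (G s) ^ 2 + Im (G s) ^ 2)%R Rinv).
    - simpl; apply @continuous_plus; repeat apply @continuous_mult; auto;
        apply continuous_const.
    - now apply continuous_Rinv. }
  split.
  - exact (continuous_mult _ _ _ G1 N).
  - exact (continuous_mult _ _ _ (continuous_opp _ _ G2) N).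
Qed.

Lemma path_continuous_Cexp (G : R -> C) (t : R) :
  path_continuous G t -> path_continuous (fun s => Cexp (G s)) t.
Proof.
  intros [G1 G2]; split; unfold Cexp; simpl; apply @continuous_mult.
  - apply (continuous_comp (fun s => Re (G s)) exp); [exact G1 | apply continuous_exp].
  - apply (continuous_comp (fun s => Im (G s)) cos); [exact G2 | apply continuous_cos].
  - apply (continuous_comp (fun s => Re (G s)) exp); [exact G1 | apply continuous_exp].
  - apply (continuous_comp (fun s => Im (G s)) sin); [exact G2 | apply continuous_sin].
Qed.

(* The closed-interval fundamental theorem does not apply, since the
   derivative of [G] may fail to exist at the end points. *)
Lemma is_RInt_derive_open (G f : R -> R) (a b : R) :
  (a < b)%R ->
  (forall t, continuous G t) ->
  (forall t, (a < t < b)%R -> is_derive G t (f t) /\ continuous f t) ->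
  (exists d, filterlim f (at_right a) (locally d)) ->
  (exists d, filterlim f (at_left b) (locally d)) ->
  is_RInt f a b (G b - G a)%R.
Proof.
  intros Hab HG Hd [da Ha] [db Hb].
  (* The one-sided limits extend [f] from the open interval to a function [h] continuous on the
     whole line, with the same integral. *)
  destruct (C0_extension_lt f da db a b Hab) as [h [Hc [He _]]]; auto.
  { intros c Hcc; apply (Hd c Hcc). }
  assert (Ih : forall x, ex_RInt h a x).
  { intros x; apply @ex_RInt_continuous; intros; apply Hc. }
  assert (Dh : forall x, is_derive (fun x => RInt h a x) x (h x)).
  { intros x; apply is_derive_RInt with a; [| apply Hc].
    apply filter_forall; intros y; apply @RInt_correct, Ih. }
  (* The mean value theorem asks for derivatives inside the interval and for continuity at its ends,
     which is what [G] offers. *)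
  destruct (MVT_gen (fun x => RInt h a x - G x)%R a b (fun _ => 0%R)) as [c [_ E]].
  - rewrite Rmin_left, Rmax_right by lra; intros x Hx.
    replace 0%R with (h x - f x)%R by (rewrite (He x Hx); ring).
    apply @is_derive_minus; [apply Dh | apply (Hd x Hx)].
  - intros x _; apply continuity_pt_filterlim.
    apply (continuous_minus (fun x => RInt h a x) G); [| apply HG].
    apply ex_derive_continuous; eexists; apply Dh.
  - rewrite RInt_point in E; unfold zero in E; simpl in E.
    replace (G b - G a)%R with (RInt h a b) by lra.
    apply is_RInt_ext with h.
    + rewrite Rmin_left, Rmax_right by lra; auto.
    + apply @RInt_correct, Ih.
Qed.

(** Induction on the breakpoints for all intervals at once: a breakpoint inside splits the interval,
    one outside is dropped. Hence the list may be unordered and contain repetitions. *)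
Lemma is_RInt_derive_piecewise (G f : R -> R) (l : list R) (a b : R) :
  (a < b)%R ->
  (forall t, continuous G t) ->
  (forall t, (exists d, filterlim f (at_left t) (locally d)) /\
             (exists d, filterlim f (at_right t) (locally d))) ->
  (forall t, (a < t < b)%R -> ~ In t l -> is_derive G t (f t) /\ continuous f t) ->
  is_RInt f a b (G b - G a)%R.
Proof.
  intros Hab HG Hlim; revert a b Hab.
  induction l as [|p l IH]; intros a b Hab Hd.
  { apply is_RInt_derive_open; auto; apply Hlim. }
  destruct (Rlt_dec a p) as [Hap|Hap].
  - destruct (Rlt_dec p b) as [Hpb|Hpb].
    + replace (G b - G a)%R with (plus (G p - G a)%R (G b - G p)%R)
        by (unfold plus; simpl; ring).
      apply (is_RInt_Chasles (V := R_NormedModule)) with p; apply IH; auto; intros t Ht Hl;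
        (apply Hd; [lra | intros [E|E]; [lra | now apply Hl]]).
    + apply IH; auto; intros t Ht Hl; apply Hd; auto; intros [E|E]; [lra | tauto].
  - apply IH; auto; intros t Ht Hl; apply Hd; auto; intros [E|E]; [lra | tauto].
Qed.

(** * Limits and primitives of complex-valued functions along a path *)

Definition Ctends (F : (R -> Prop) -> Prop) (h : R -> C) (l : C) : Prop :=
  filterlim (fun t => Re (h t)) F (locally (Re l)) /\
  filterlim (fun t => Im (h t)) F (locally (Im l)).

Lemma filterlim_Re (T : Type) (F : (T -> Prop) -> Prop) (h : T -> C) (l : C) :
  filterlim h F (locally l) -> filterlim (fun t => Re (h t)) F (locally (Re l)).
Proof.
  intros H; apply (filterlim_comp _ _ _ h (fun z : C => Re z) F (locally l)); auto.
  destruct l; apply (continuous_fst (U := R_UniformSpace) (V := R_UniformSpace)).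
Qed.

Lemma filterlim_Im (T : Type) (F : (T -> Prop) -> Prop) (h : T -> C) (l : C) :
  filterlim h F (locally l) -> filterlim (fun t => Im (h t)) F (locally (Im l)).
Proof.
  intros H; apply (filterlim_comp _ _ _ h (fun z : C => Im z) F (locally l)); auto.
  destruct l; apply (continuous_snd (U := R_UniformSpace) (V := R_UniformSpace)).
Qed.

Lemma filterlim_Rminus (T : Type) (F : (T -> Prop) -> Prop) {FF : Filter F}
  (u v : T -> R) (x y : R) :
  filterlim u F (locally x) -> filterlim v F (locally y) ->
  filterlim (fun t => u t - v t)%R F (locally (x - y)%R).
Proof.
  intros U V.
  apply (filterlim_comp_2 u (fun t => - v t)%R Rplus U (H := locally (- y)%R)).
  - apply (filterlim_comp _ _ _ v Ropp _ (locally y)); auto.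
    apply (filterlim_opp (V := R_NormedModule)).
  - apply (filterlim_plus (V := R_NormedModule)).
Qed.

Lemma Ctends_plus (F : (R -> Prop) -> Prop) {FF : Filter F} (h k : R -> C) (l m : C) :
  Ctends F h l -> Ctends F k m -> Ctends F (fun t => h t + k t) (l + m).
Proof.
  intros [H1 H2] [K1 K2]; split; simpl.
  - exact (filterlim_comp_2 _ _ Rplus H1 K1 (filterlim_plus (V := R_NormedModule) _ _)).
  - exact (filterlim_comp_2 _ _ Rplus H2 K2 (filterlim_plus (V := R_NormedModule) _ _)).
Qed.

Lemma Ctends_mult (F : (R -> Prop) -> Prop) {FF : Filter F} (h k : R -> C) (l m : C) :
  Ctends F h l -> Ctends F k m -> Ctends F (fun t => h t * k t) (l * m).
Proof.
  assert (M : forall (u v : R -> R) (x y : R),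
    filterlim u F (locally x) -> filterlim v F (locally y) ->
    filterlim (fun t => u t * v t)%R F (locally (x * y)%R)).
  { intros u v x y U V.
    exact (filterlim_comp_2 _ _ Rmult U V (filterlim_mult (K := R_AbsRing) _ _)). }
  intros [H1 H2] [K1 K2]; split; simpl.
  - exact (filterlim_Rminus _ _ _ _ _ _ (M _ _ _ _ H1 K1) (M _ _ _ _ H2 K2)).
  - exact (filterlim_comp_2 _ _ Rplus (M _ _ _ _ H1 K2) (M _ _ _ _ H2 K1)
             (filterlim_plus (V := R_NormedModule) _ _)).
Qed.

Lemma Ctends_const (F : (R -> Prop) -> Prop) {FF : Filter F} (c : C) :
  Ctends F (fun _ => c) c.
Proof. split; apply filterlim_const. Qed.

Lemma Ctends_of_path_continuous (F : (R -> Prop) -> Prop) (h : R -> C) (t : R) :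
  filter_le F (locally t) -> path_continuous h t -> Ctends F h (h t).
Proof.
  intros H [H1 H2]; split; intros P HP; apply H; [now apply H1 | now apply H2].
Qed.

(** A chain rule along [g] takes the place of [Phi' = f], so [f] and [Phi] matter only on the path
    and a pole elsewhere does no harm. The closure rules for sums, products, inverses and
    exponentials are inherited from [is_path_derive]. *)
Definition path_primitive (g : R -> C) (f Phi : C -> C) : Prop :=
  (forall t, path_continuous (fun s => Phi (g s)) t) /\
  (forall t d, is_path_derive g t d ->
     is_path_derive (fun s => Phi (g s)) t (f (g t) * d)).

Lemma ex_derive_is_path_derive (g : R -> C) (t : R) :
  ex_derive (V := C_R_NormedModule) g t -> is_path_derive g t (path_derive g t).
Proof.
  intros [l H].
  assert (D : forall p : C -> R, is_linear (U := C_R_NormedModule) (V := R_NormedModule) p ->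
    ex_derive (fun s => p (g s)) t).
  { intros p Hp; exists (p l).
    unfold is_derive in *.
    apply filterdiff_ext_lin with (fun y => p (scal y l)).
    - apply (filterdiff_comp' g p t _ p H).
      now apply filterdiff_linear.
    - intros y; exact (linear_scal (U := C_R_NormedModule) (V := R_NormedModule) p Hp y l). }
  split; unfold path_derive; simpl; apply Derive_correct.
  - apply (D Re); apply (is_linear_fst (K := R_AbsRing) (U := R_NormedModule) (V := R_NormedModule)).
  - apply (D Im); apply (is_linear_snd (K := R_AbsRing) (U := R_NormedModule) (V := R_NormedModule)).
Qed.

Lemma piecewise_C1_path_continuous (g : R -> C) (t : R) :
  piecewise_C1 g -> path_continuous g t.
Proof.
  intros [H _]; split.
  - apply filterlim_Re, (H t).
  - apply filterlim_Im, (H t).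
Qed.

(** At a breakpoint the integrand keeps one-sided limits, being the product of the continuous
    [f (g t)] and of [path_derive g], which has them. Each component then falls under
    [is_RInt_derive_piecewise]. *)
Lemma is_RInt_path_primitive (g : R -> C) (f Phi : C -> C) (a b : R) :
  (a < b)%R ->
  piecewise_C1 g ->
  (forall t, path_continuous (fun s => f (g s)) t) ->
  path_primitive g f Phi ->
  is_RInt (V := C_R_NormedModule) (fun t => f (g t) * path_derive g t) a b
    (Phi (g b) - Phi (g a)).
Proof.
  intros Hab [_ [Hpc Hlim]] Hf [Pc Pd].
  destruct (Hpc a b) as [l Hl].
  assert (LL : forall t, exists d, Ctends (at_left t) (fun t => f (g t) * path_derive g t) d).
  { intros t; destruct (Hlim t) as [[d Hd] _]; exists (f (g t) * d).
    apply Ctends_mult; [apply at_left_proper_filter | |].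
    - apply (Ctends_of_path_continuous _ (fun s => f (g s))); [| apply Hf].
      apply filter_le_within.
    - split; [now apply filterlim_Re | now apply filterlim_Im]. }
  assert (LR : forall t, exists d, Ctends (at_right t) (fun t => f (g t) * path_derive g t) d).
  { intros t; destruct (Hlim t) as [_ [d Hd]]; exists (f (g t) * d).
    apply Ctends_mult; [apply at_right_proper_filter | |].
    - apply (Ctends_of_path_continuous _ (fun s => f (g s))); [| apply Hf].
      apply filter_le_within.
    - split; [now apply filterlim_Re | now apply filterlim_Im]. }
  assert (D : forall t, (a < t < b)%R -> ~ In t l ->
    is_path_derive (fun s => Phi (g s)) t (f (g t) * path_derive g t) /\
    path_continuous (fun t => f (g t) * path_derive g t) t).
  { intros t Ht Hn; destruct (Hl t Ht Hn) as [H1 H2]; split.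
    - apply Pd; now apply ex_derive_is_path_derive.
    - apply (path_continuous_mult (fun t => f (g t))); [apply Hf |].
      split; [now apply filterlim_Re | now apply filterlim_Im]. }
  apply (is_RInt_fct_extend_pair (U := R_NormedModule) (V := R_NormedModule)).
  - apply (is_RInt_derive_piecewise (fun t => Re (Phi (g t))) (fun t => Re (f (g t) * path_derive g t)) l); auto.
    + intros t; apply Pc.
    + intros t; split; [destruct (LL t) as [d [H _]] | destruct (LR t) as [d [H _]]];
        exists (Re d); exact H.
    + intros t Ht Hn; split; apply (D t Ht Hn).
  - apply (is_RInt_derive_piecewise (fun t => Im (Phi (g t))) (fun t => Im (f (g t) * path_derive g t)) l); auto.
    + intros t; apply Pc.
    + intros t; split; [destruct (LL t) as [d [_ H]] | destruct (LR t) as [d [_ H]]];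
        exists (Im d); exact H.
    + intros t Ht Hn; split; apply (D t Ht Hn).
Qed.

Lemma is_contour_integral_primitive (g : R -> C) (f Phi : C -> C) (lm lp : C) :
  piecewise_C1 g ->
  (forall t, path_continuous (fun s => f (g s)) t) ->
  path_primitive g f Phi ->
  Ctends (Rbar_locally m_infty) (fun t => Phi (g t)) lm ->
  Ctends (Rbar_locally p_infty) (fun t => Phi (g t)) lp ->
  is_contour_integral g f (lp - lm).
Proof.
  intros Hg Hf HP [M1 M2] [P1 P2].
  assert (L : filterlim (fun ab : R * R => Phi (g (snd ab)) - Phi (g (fst ab)))
    (filter_prod (Rbar_locally m_infty) (Rbar_locally p_infty)) (locally (lp - lm))).
  { assert (S : forall (u : R -> R) (x y : R),
      filterlim u (Rbar_locally m_infty) (locally x) ->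
      filterlim u (Rbar_locally p_infty) (locally y) ->
      filterlim (fun ab : R * R => (u (snd ab) - u (fst ab))%R)
        (filter_prod (Rbar_locally m_infty) (Rbar_locally p_infty)) (locally (y - x)%R)).
    { intros u x y X Y.
      apply (filterlim_Rminus _ _ (fun ab : R * R => u (snd ab)) (fun ab : R * R => u (fst ab))).
      - exact (filterlim_comp _ _ _ snd u _ _ _ filterlim_snd Y).
      - exact (filterlim_comp _ _ _ fst u _ _ _ filterlim_fst X). }
    pose proof (S _ _ _ M1 P1) as A1; pose proof (S _ _ _ M2 P2) as A2.
    pose proof (filterlim_pair _ _ A1 A2) as A.
    intros Q HQ.
    specialize (A Q).
    apply A. 
    destruct HQ as [eps HQ].
    exists (fun x => ball (Re (lp - lm)) eps x) (fun y => ball (Im (lp - lm)) eps y).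
    - now exists eps.
    - now exists eps.
    - intros x y Hx Hy; apply HQ; split; assumption. }
  intros Q HQ.
  (* The two end points move independently; eventually [0] separates them, which provides the order
     that [is_RInt_path_primitive] asks for. *)
  assert (E : filter_prod (Rbar_locally m_infty) (Rbar_locally p_infty)
    (fun ab : R * R => (fst ab < snd ab)%R)).
  { exists (fun x => (x < 0)%R) (fun y => (0 < y)%R).
    - now exists 0%R.
    - now exists 0%R.
    - simpl; intros; lra. }
  specialize (L Q HQ).
  unfold filtermapi; unfold filtermap in L.
  generalize (filter_and _ _ L E); apply filter_imp.
  intros [x y] [H1 H2]; simpl in H1, H2.
  exists (Phi (g y) - Phi (g x)); split; [| exact H1].
  now apply is_RInt_path_primitive.
Qed.

(** * The Gaussian integral *)

Section Gauss.
Local Open Scope R_scope.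

Lemma exp_le_mono (x y : R) : x <= y -> exp x <= exp y.
Proof. intros [H | ->]; [left; now apply exp_increasing | lra]. Qed.

Definition gauss_int (x : R) : R := RInt (fun s => exp (- s ^ 2)) 0 x.

Lemma continuous_gauss (x : R) : continuous (fun s => exp (- s ^ 2)) x.
Proof. apply @ex_derive_continuous; auto_derive; auto. Qed.

Lemma ex_RInt_gauss (a b : R) : ex_RInt (fun s => exp (- s ^ 2)) a b.
Proof. apply @ex_RInt_continuous; intros; apply continuous_gauss. Qed.

Lemma is_derive_gauss_int (x : R) : is_derive gauss_int x (exp (- x ^ 2)).
Proof.
  apply (is_derive_RInt (fun s => exp (- s ^ 2)) gauss_int 0 x).
  - apply filter_forall; intros y; apply @RInt_correct, ex_RInt_gauss.
  - apply continuous_gauss.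
Qed.

Lemma gauss_int_opp (x : R) : gauss_int (- x) = - gauss_int x.
Proof.
  pose proof (RInt_comp_lin (V := R_CompleteNormedModule) (fun s => exp (- s ^ 2))
    (-1) 0 0 x (ex_RInt_gauss _ _)) as E.
  replace (-1 * 0 + 0) with 0 in E by ring; replace (-1 * x + 0) with (- x) in E by ring.
  unfold gauss_int; rewrite <- E.
  rewrite <- (RInt_opp (V := R_CompleteNormedModule) (fun s => exp (- s ^ 2)))
    by apply ex_RInt_gauss.
  apply RInt_ext; intros y _; unfold scal, opp; simpl; unfold mult; simpl.
  replace ((-1 * y + 0) * ((-1 * y + 0) * 1)) with (y * (y * 1)) by ring; ring.
Qed.

(* Chosen so that [gauss_int x ^ 2 + RInt (gauss_aux x) 0 1] has derivative [0] in [x]. *)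
Definition gauss_aux (x t : R) : R := exp (- x ^ 2 * (1 + t ^ 2)) / (1 + t ^ 2).

Lemma one_plus_sqr_pos (t : R) : 0 < 1 + t ^ 2.
Proof. nra. Qed.

Lemma is_derive_gauss_aux (x t : R) :
  is_derive (fun u => gauss_aux u t) x (- 2 * x * exp (- x ^ 2 * (1 + t ^ 2))).
Proof.
  pose proof (one_plus_sqr_pos t).
  unfold gauss_aux; auto_derive; [split; auto; simpl in H; lra |].
  change (x * (x * 1)) with (x ^ 2); change (t * (t * 1)) with (t ^ 2).
  field; lra.
Qed.

Lemma Derive_gauss_aux (x t : R) :
  Derive (fun u : R => gauss_aux u t) x = - 2 * x * exp (- x ^ 2 * (1 + t ^ 2)).
Proof. exact (is_derive_unique _ _ _ (is_derive_gauss_aux x t)). Qed.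

Lemma continuous_gauss_aux (x t : R) : continuous (gauss_aux x) t.
Proof.
  pose proof (one_plus_sqr_pos t).
  apply @ex_derive_continuous; unfold gauss_aux; auto_derive; simpl in H; lra.
Qed.

(** Differentiation under the integral sign cancels the denominator [1 + t^2]; the factor
    [exp (- x^2)] splits off, and the substitution [s = x t] turns what is left into
    [gauss_int x]. *)
Lemma is_derive_RInt_gauss_aux (x : R) :
  is_derive (fun u => RInt (fun t => gauss_aux u t) 0 1) x
    (- 2 * exp (- x ^ 2) * gauss_int x).
Proof.
  assert (E : - 2 * exp (- x ^ 2) * gauss_int x =
    RInt (fun t => Derive (fun u => gauss_aux u t) x) 0 1).
  { pose proof (RInt_comp_lin (V := R_CompleteNormedModule) (fun s => exp (- s ^ 2))
      x 0 0 1 (ex_RInt_gauss _ _)) as E.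
    replace (x * 0 + 0) with 0 in E by ring; replace (x * 1 + 0) with x in E by ring.
    unfold gauss_int; rewrite <- E.
    refine (eq_trans (eq_sym (RInt_scal (V := R_CompleteNormedModule) _ 0 1
      (- 2 * exp (- x ^ 2)) _)) _).
    - apply @ex_RInt_continuous; intros; apply @ex_derive_continuous.
      unfold scal; simpl; unfold mult; simpl; auto_derive; auto.
    - apply RInt_ext; intros t _.
      rewrite Derive_gauss_aux.
      replace (- x ^ 2 * (1 + t ^ 2)) with (- x ^ 2 + - (x * t + 0) ^ 2) by ring.
      rewrite exp_plus; unfold scal; simpl; unfold mult; simpl; ring. }
  rewrite E; apply is_derive_RInt_param.
  - apply filter_forall; intros y t _; eexists; apply is_derive_gauss_aux.
  - intros t _.
    apply continuity_2d_pt_ext with (fun u v => - 2 * u * exp (- u ^ 2 * (1 + v ^ 2))).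
    + intros u v; now rewrite Derive_gauss_aux.
    + apply continuity_2d_pt_mult.
      * apply continuity_2d_pt_mult; [apply continuity_2d_pt_const | apply continuity_2d_pt_id1].
      * apply (continuity_1d_2d_pt_comp exp).
        -- apply derivable_continuous_pt, derivable_pt_exp.
        -- simpl; repeat first [ apply continuity_2d_pt_mult | apply continuity_2d_pt_opp
             | apply continuity_2d_pt_plus | apply continuity_2d_pt_const
             | apply continuity_2d_pt_id1 | apply continuity_2d_pt_id2 ].
  - apply filter_forall; intros y; apply @ex_RInt_continuous; intros; apply continuous_gauss_aux.
Qed.

Lemma gauss_int_sqr (x : R) :
  gauss_int x ^ 2 + RInt (fun t => gauss_aux x t) 0 1 = PI / 4.
Proof.
  assert (D : forall y, is_derive
    (fun x => gauss_int x ^ 2 + RInt (fun t => gauss_aux x t) 0 1) y 0).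
  { intros y.
    refine (eq_ind (2 * exp (- y ^ 2) * gauss_int y + - 2 * exp (- y ^ 2) * gauss_int y)
      (fun d => is_derive _ y d) _ 0 ltac:(ring)).
    apply @is_derive_plus; [| apply is_derive_RInt_gauss_aux].
    apply (is_derive_ext (fun x => gauss_int x * gauss_int x)); [intros t; change (gauss_int t * gauss_int t = gauss_int t ^ 2); ring |].
    replace (2 * exp (- y ^ 2) * gauss_int y)
      with (exp (- y ^ 2) * gauss_int y + gauss_int y * exp (- y ^ 2)) by ring.
    apply (is_derive_mult gauss_int gauss_int); try apply is_derive_gauss_int.
    intros; apply Rmult_comm. }
  destruct (MVT_gen (fun x => gauss_int x ^ 2 + RInt (fun t => gauss_aux x t) 0 1) 0 x
              (fun _ => 0)) as [c [_ E]].
  - intros; apply D.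
  - intros y _; apply continuity_pt_filterlim.
    apply (ex_derive_continuous (V := R_NormedModule)
      (fun x => gauss_int x ^ 2 + RInt (fun t => gauss_aux x t) 0 1)); eexists; apply D.
  (* The constant is the value at [x = 0], where [gauss_aux 0 t = 1 / (1 + t^2)] integrates to
     [atan 1 = PI / 4]. *)
  - assert (Z : gauss_int 0 = 0) by apply @RInt_point.
    assert (A : is_RInt (fun t => gauss_aux 0 t) 0 1 (atan 1 - atan 0)).
    { apply (is_RInt_ext (fun t => / (1 + t ^ 2))).
      - intros t _; unfold gauss_aux.
        replace (- 0 ^ 2 * (1 + t ^ 2)) with 0 by ring; rewrite exp_0; symmetry; apply Rmult_1_l.
      - apply (is_RInt_derive (V := R_CompleteNormedModule) atan (fun t => / (1 + t ^ 2))).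
        + intros t _; rewrite <- Rsqr_pow2; apply is_derive_atan.
        + intros t _; apply @ex_derive_continuous; auto_derive.
          pose proof (one_plus_sqr_pos t) as H; simpl in H; lra. }
    apply (is_RInt_unique (V := R_CompleteNormedModule)) in A; rewrite atan_1, atan_0 in A.
    rewrite Z, A in E; lra.
Qed.

Lemma RInt_gauss_aux_bound (x : R) :
  0 <= RInt (fun t => gauss_aux x t) 0 1 <= exp (- x ^ 2).
Proof.
  assert (I : ex_RInt (fun t => gauss_aux x t) 0 1).
  { apply @ex_RInt_continuous; intros; apply continuous_gauss_aux. }
  assert (P : forall t, 0 <= gauss_aux x t <= exp (- x ^ 2)).
  { intros t; unfold gauss_aux; pose proof (one_plus_sqr_pos t) as Ht.
    assert (1 <= 1 + t ^ 2) by nra.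
    pose proof (exp_pos (- x ^ 2 * (1 + t ^ 2))) as He.
    split.
    - apply Rmult_le_pos; [lra |]; left; now apply Rinv_0_lt_compat.
    - assert (exp (- x ^ 2 * (1 + t ^ 2)) <= exp (- x ^ 2)).
      { apply exp_le_mono; nra. }
      apply Rmult_le_reg_r with (1 + t ^ 2); auto.
      unfold Rdiv; rewrite Rmult_assoc, Rinv_l by lra.
      pose proof (exp_pos (- x ^ 2)); nra. }
  split.
  - apply RInt_ge_0; [lra | exact I |]; intros; apply P.
  - replace (exp (- x ^ 2)) with (RInt (fun _ => exp (- x ^ 2)) 0 1).
    + apply RInt_le; [lra | exact I | apply ex_RInt_const |]; intros; apply P.
    + rewrite RInt_const; unfold scal; simpl; unfold mult; simpl; ring.
Qed.

Lemma gauss_int_nonneg (x : R) : 0 <= x -> 0 <= gauss_int x.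
Proof.
  intros Hx; apply RInt_ge_0; auto; [apply ex_RInt_gauss |].
  intros; left; apply exp_pos.
Qed.

Lemma gauss_int_limit_bound (x : R) :
  0 <= x -> Rabs (gauss_int x - sqrt PI / 2) <= 2 * exp (- x ^ 2).
Proof.
  intros Hx; pose proof (gauss_int_sqr x) as E.
  pose proof (RInt_gauss_aux_bound x) as B.
  pose proof (gauss_int_nonneg x Hx) as P.
  assert (S : sqrt PI * sqrt PI = PI) by (apply sqrt_sqrt; pose proof PI_RGT_0; lra).
  assert (S1 : 1 <= sqrt PI).
  { rewrite <- sqrt_1; apply sqrt_le_1_alt; pose proof PI2_1; lra. }
  set (e := exp (- x ^ 2)) in *; set (K := RInt (fun t => gauss_aux x t) 0 1) in *.
  (* The second factor is at least [1 / 2] because [sqrt PI >= 1]; so the first is at most [2 K],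
     and this is the factor [2] of the bound. *)
  assert (F : (sqrt PI / 2 - gauss_int x) * (sqrt PI / 2 + gauss_int x) = K) by nra.
  assert (0 <= sqrt PI / 2 - gauss_int x) by nra.
  rewrite Rabs_left1 by lra.
  nra.
Qed.
End Gauss.

(** * The entire primitive of the Gaussian *)

Section ComplexGauss.
Local Open Scope R_scope.

Lemma continuous_comp_2d_pt (f : R -> R -> R) (u v : R -> R) (t : R) :
  continuity_2d_pt f (u t) (v t) -> continuous u t -> continuous v t ->
  continuous (fun s => f (u s) (v s)) t.
Proof.
  intros Hf Hu Hv; apply continuity_2d_pt_filterlim in Hf.
  apply (continuous_comp_2 u v f); assumption.
Qed.

(** Since [dh] is both the [x]-derivative of [h] and the [s]-derivative of [H], differentiation
    under the integral leaves an exact integrand and only boundary values survive. The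
    Cauchy-Riemann equations supply such pairs [h], [H]. *)
Lemma is_derive_RInt_param_primitive (h H dh : R -> R -> R) (x y : R) :
  (forall u s, is_derive (fun z => h z s) u (dh u s)) ->
  (forall u s, is_derive (fun z => H u z) s (dh u s)) ->
  (forall u s, continuity_2d_pt dh u s) ->
  (forall u s, continuous (h u) s) ->
  is_derive (fun u => RInt (fun s => h u s) 0 y) x (H x y - H x 0).
Proof.
  intros Dh DH Cd Ch.
  assert (E : forall u s, Derive (fun z : R => h z s) u = dh u s).
  { intros u s; exact (is_derive_unique _ _ _ (Dh u s)). }
  assert (Hx : H x y - H x 0 = RInt (fun t => Derive (fun u => h u t) x) 0 y).
  { symmetry; apply (is_RInt_unique (V := R_CompleteNormedModule)).
    apply (is_RInt_ext (dh x)); [intros; now rewrite E |].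
    apply (is_RInt_derive (V := R_CompleteNormedModule) (H x)); [intros; apply DH |].
    intros s _.
    apply (continuous_comp_2d_pt dh (fun _ => x) (fun s => s));
      [apply Cd | apply continuous_const | apply continuous_id]. }
  rewrite Hx; apply is_derive_RInt_param.
  - apply filter_forall; intros u t _; eexists; apply Dh.
  - intros t _; apply continuity_2d_pt_ext with dh; [intros; now rewrite E | apply Cd].
  - apply filter_forall; intros u; apply @ex_RInt_continuous; intros; apply Ch.
Qed.

Definition egauss_cos (x s : R) : R := exp (s ^ 2 - x ^ 2) * cos (2 * x * s).
Definition egauss_sin (x s : R) : R := exp (s ^ 2 - x ^ 2) * sin (2 * x * s).

Lemma Cexp_opp_sqr (z : C) :
  Cexp (- z ^ 2)%C = (egauss_cos (Re z) (Im z), - egauss_sin (Re z) (Im z)).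
Proof.
  destruct z as [x y]; unfold Cexp, egauss_cos, egauss_sin, Re, Im; simpl.
  replace (- (x * (x * 1 - y * 0) - y * (x * 0 + y * 1)))
    with (y * (y * 1) - x * (x * 1)) by ring.
  replace (- (x * (x * 0 + y * 1) + y * (x * 1 - y * 0))) with (- (2 * x * y)) by ring.
  rewrite cos_neg, sin_neg; f_equal; ring.
Qed.

Ltac cont2d := unfold egauss_cos, egauss_sin; simpl;
  repeat first [ apply continuity_2d_pt_mult | apply continuity_2d_pt_opp
    | apply continuity_2d_pt_minus | apply continuity_2d_pt_plus
    | apply continuity_2d_pt_const | apply continuity_2d_pt_id1 | apply continuity_2d_pt_id2
    | apply (continuity_1d_2d_pt_comp exp);
      [apply derivable_continuous_pt, derivable_pt_exp |]
    | apply (continuity_1d_2d_pt_comp cos); [apply continuity_cos |]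
    | apply (continuity_1d_2d_pt_comp sin); [apply continuity_sin |] ].

Lemma continuity_2d_egauss_cos (x y : R) : continuity_2d_pt egauss_cos x y.
Proof. apply continuity_2d_pt_ext with (fun x y => egauss_cos x y); [reflexivity |]. cont2d. Qed.

Lemma continuity_2d_egauss_sin (x y : R) : continuity_2d_pt egauss_sin x y.
Proof. apply continuity_2d_pt_ext with (fun x y => egauss_sin x y); [reflexivity |]. cont2d. Qed.

Lemma continuous_egauss_cos (x s : R) : continuous (egauss_cos x) s.
Proof. apply @ex_derive_continuous; unfold egauss_cos; auto_derive; auto. Qed.

Lemma continuous_egauss_sin (x s : R) : continuous (egauss_sin x) s.
Proof. apply @ex_derive_continuous; unfold egauss_sin; auto_derive; auto. Qed.

(** Cauchy-Riemann for [exp (- z^2) = egauss_cos - i egauss_sin]. The boundary term at [s = 0] is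
    what the derivative of [gauss_int] cancels in [cgauss_re]. *)
Lemma is_derive_RInt_egauss_sin (x y : R) :
  is_derive (fun u => RInt (egauss_sin u) 0 y) x (egauss_cos x y - exp (- x ^ 2)).
Proof.
  replace (exp (- x ^ 2)) with (egauss_cos x 0).
  2: { unfold egauss_cos; rewrite Rmult_0_r, cos_0, Rmult_1_r; f_equal; ring. }
  apply (is_derive_RInt_param_primitive egauss_sin egauss_cos
    (fun x s => 2 * s * egauss_cos x s - 2 * x * egauss_sin x s)).
  - intros u s; unfold egauss_sin, egauss_cos; auto_derive; auto; unfold Rminus; simpl; ring.
  - intros u s; unfold egauss_sin, egauss_cos; auto_derive; auto; unfold Rminus; simpl; ring.
  - intros u s; cont2d.
  - intros; apply continuous_egauss_sin.
Qed.

Lemma is_derive_RInt_egauss_cos (x y : R) :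
  is_derive (fun u => RInt (egauss_cos u) 0 y) x (- egauss_sin x y).
Proof.
  replace (- egauss_sin x y) with (- egauss_sin x y - - egauss_sin x 0).
  2: { unfold egauss_sin; rewrite Rmult_0_r, sin_0; ring. }
  apply (is_derive_RInt_param_primitive egauss_cos (fun x s => - egauss_sin x s)
    (fun x s => - 2 * s * egauss_sin x s - 2 * x * egauss_cos x s)).
  - intros u s; unfold egauss_sin, egauss_cos; auto_derive; auto; unfold Rminus; simpl; ring.
  - intros u s; unfold egauss_sin, egauss_cos; auto_derive; auto; unfold Rminus; simpl; ring.
  - intros u s; cont2d.
  - intros; apply continuous_egauss_cos.
Qed.

Lemma is_derive_RInt_upper (f : R -> R) (y : R) :
  (forall s, continuous f s) -> is_derive (fun z => RInt f 0 z) y (f y).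
Proof.
  intros Hf; apply (is_derive_RInt f (fun z => RInt f 0 z) 0 y); [| apply Hf].
  apply filter_forall; intros z; apply @RInt_correct, @ex_RInt_continuous; intros; apply Hf.
Qed.

(* Integrating [exp (- z^2)] from [0] to [x] along the real axis, then
   vertically from [x] to [x + i y]. *)
Definition cgauss_re (x y : R) : R := gauss_int x + RInt (egauss_sin x) 0 y.
Definition cgauss_im (x y : R) : R := RInt (egauss_cos x) 0 y.

(** A path moves in both coordinates at once, so its chain rule needs total differentiability and
    not just the two partial derivatives. *)
Lemma differentiable_of_partials (f dfx dfy : R -> R -> R) (x y : R) :
  (forall u v, is_derive (fun z => f z v) u (dfx u v)) ->
  (forall u v, is_derive (fun z => f u z) v (dfy u v)) ->
  continuity_2d_pt dfx x y ->
  differentiable_pt_lim f x y (dfx x y) (dfy x y).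
Proof.
  intros Dx Dy Cx; apply filterdiff_differentiable_pt_lim.
  apply (is_derive_filterdiff f x y dfx (dfy x y)).
  - apply filter_forall; intros u; apply Dx.
  - apply Dy.
  - now apply continuity_2d_pt_filterlim.
Qed.

Lemma differentiable_cgauss_re (x y : R) :
  differentiable_pt_lim cgauss_re x y (egauss_cos x y) (egauss_sin x y).
Proof.
  apply differentiable_of_partials; [| | apply continuity_2d_egauss_cos].
  - intros u v; unfold cgauss_re.
    replace (egauss_cos u v) with (exp (- u ^ 2) + (egauss_cos u v - exp (- u ^ 2))) by ring.
    apply (is_derive_plus gauss_int); [apply is_derive_gauss_int | apply is_derive_RInt_egauss_sin].
  - intros u v; unfold cgauss_re.
    replace (egauss_sin u v) with (0 + egauss_sin u v) by ring.
    apply (is_derive_plus (fun _ => gauss_int u) (fun z => RInt (egauss_sin u) 0 z));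
      [apply @is_derive_const |].
    apply is_derive_RInt_upper; intros; apply continuous_egauss_sin.
Qed.

Lemma differentiable_cgauss_im (x y : R) :
  differentiable_pt_lim cgauss_im x y (- egauss_sin x y) (egauss_cos x y).
Proof.
  apply (differentiable_of_partials cgauss_im (fun x y => - egauss_sin x y) egauss_cos).
  - intros u v; apply is_derive_RInt_egauss_cos.
  - intros u v; apply is_derive_RInt_upper; intros; apply continuous_egauss_cos.
  - apply continuity_2d_pt_opp, continuity_2d_egauss_sin.
Qed.

Definition cgauss (z : C) : C := (cgauss_re (Re z) (Im z), cgauss_im (Re z) (Im z)).

(** The gradients of [cgauss_re] and [cgauss_im] are [(egauss_cos, egauss_sin)] and
    [(- egauss_sin, egauss_cos)]; applied to the velocity [d] they amount to complex multiplication
    by [exp (- z^2)]. *)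
Lemma path_primitive_cgauss (g : R -> C) :
  (forall t, path_continuous g t) ->
  path_primitive g (fun z => Cexp (- z ^ 2)%C) cgauss.
Proof.
  intros Hg; split.
  - intros t; destruct (Hg t) as [H1 H2]; split.
    + apply (continuous_comp_2d_pt cgauss_re); auto.
      apply differentiable_continuity_pt; eexists; eexists; apply differentiable_cgauss_re.
    + apply (continuous_comp_2d_pt cgauss_im); auto.
      apply differentiable_continuity_pt; eexists; eexists; apply differentiable_cgauss_im.
  - intros t d [D1 D2]; rewrite Cexp_opp_sqr.
    apply is_derive_Reals in D1; apply is_derive_Reals in D2; split; apply is_derive_Reals.
    + refine (eq_ind _ (fun l => derivable_pt_lim _ t l)
        (derivable_pt_lim_comp_2d _ _ _ t _ _ _ _ (differentiable_cgauss_re _ _) D1 D2) _ _).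
      destruct d; simpl; unfold Re, Im; simpl; ring.
    + refine (eq_ind _ (fun l => derivable_pt_lim _ t l)
        (derivable_pt_lim_comp_2d _ _ _ t _ _ _ _ (differentiable_cgauss_im _ _) D1 D2) _ _).
      destruct d; simpl; unfold Re, Im; simpl; ring.
Qed.

(** * Distance of the entire primitive from its limits *)

Lemma abs_RInt_le_sym (f : R -> R) (y M : R) :
  (forall s, continuous f s) ->
  (forall s, Rabs s <= Rabs y -> Rabs (f s) <= M) ->
  Rabs (RInt f 0 y) <= Rabs y * M.
Proof.
  intros Hf HM.
  assert (I : forall a b, ex_RInt f a b)
    by (intros; apply @ex_RInt_continuous; intros; apply Hf).
  destruct (Rle_dec 0 y) as [H|H].
  - rewrite (Rabs_right y) in * by lra.
    replace (y * M) with ((y - 0) * M) by ring.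
    apply abs_RInt_le_const; auto; intros; apply HM; rewrite Rabs_right; lra.
  - rewrite <- (opp_RInt_swap (V := R_CompleteNormedModule)) by apply I.
    unfold opp; simpl; rewrite Rabs_Ropp.
    rewrite (Rabs_left y) in * by lra.
    replace (- y * M) with ((0 - y) * M) by ring.
    apply abs_RInt_le_const; auto; [lra |]; intros; apply HM; rewrite Rabs_left1; lra.
Qed.

Lemma egauss_bound (x s y a : R) :
  Rabs a <= 1 -> Rabs s <= Rabs y ->
  Rabs (exp (s ^ 2 - x ^ 2) * a) <= exp (y ^ 2 - x ^ 2).
Proof.
  intros Ha Hs; rewrite Rabs_mult, (Rabs_right (exp _)) by (left; apply exp_pos).
  assert (s ^ 2 <= y ^ 2).
  { rewrite <- (pow2_abs s), <- (pow2_abs y).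
    pose proof (Rabs_pos s); nra. }
  pose proof (exp_le_mono (s ^ 2 - x ^ 2) (y ^ 2 - x ^ 2) ltac:(lra)).
  pose proof (exp_pos (s ^ 2 - x ^ 2)); pose proof (Rabs_pos a); nra.
Qed.

Lemma cgauss_im_bound (x y : R) : Rabs (cgauss_im x y) <= Rabs y * exp (y ^ 2 - x ^ 2).
Proof.
  apply abs_RInt_le_sym; [apply continuous_egauss_cos |].
  intros s Hs; apply egauss_bound; auto; apply Rabs_le, COS_bound.
Qed.

Lemma cgauss_re_bound_aux (x y : R) :
  Rabs (cgauss_re x y - gauss_int x) <= Rabs y * exp (y ^ 2 - x ^ 2).
Proof.
  unfold cgauss_re; rewrite (Rplus_comm (gauss_int x)); unfold Rminus.
  rewrite Rplus_assoc, Rplus_opp_r, Rplus_0_r.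
  apply abs_RInt_le_sym; [apply continuous_egauss_sin |].
  intros s Hs; apply egauss_bound; auto; apply Rabs_le, SIN_bound.
Qed.

Lemma exp_opp_sqr_le (x y : R) : exp (- x ^ 2) <= exp (y ^ 2 - x ^ 2).
Proof. apply exp_le_mono; nra. Qed.

(** The horizontal leg errs by at most [2 exp (- x^2)]; the vertical leg has length [|y|] and an
    integrand bounded by [exp (y^2 - x^2)]. *)
Lemma cgauss_re_bound_pos (x y : R) : 0 <= x ->
  Rabs (cgauss_re x y - sqrt PI / 2) <= (2 + Rabs y) * exp (y ^ 2 - x ^ 2).
Proof.
  intros Hx; pose proof (gauss_int_limit_bound x Hx); pose proof (cgauss_re_bound_aux x y).
  pose proof (exp_opp_sqr_le x y).
  replace (cgauss_re x y - sqrt PI / 2)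
    with ((cgauss_re x y - gauss_int x) + (gauss_int x - sqrt PI / 2)) by ring.
  eapply Rle_trans; [apply Rabs_triang | lra].
Qed.

Lemma cgauss_re_bound_neg (x y : R) : x <= 0 ->
  Rabs (cgauss_re x y - - (sqrt PI / 2)) <= (2 + Rabs y) * exp (y ^ 2 - x ^ 2).
Proof.
  intros Hx; pose proof (gauss_int_limit_bound (- x) ltac:(lra)) as H.
  pose proof (cgauss_re_bound_aux x y); pose proof (exp_opp_sqr_le x y).
  rewrite gauss_int_opp, <- Rabs_Ropp in H.
  replace (- (- x) ^ 2) with (- x ^ 2) in H by ring.
  replace (cgauss_re x y - - (sqrt PI / 2))
    with ((cgauss_re x y - gauss_int x) + - (- gauss_int x - sqrt PI / 2)) by ring.
  eapply Rle_trans; [apply Rabs_triang | lra].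
Qed.
End ComplexGauss.

(** * Hermite polynomials *)

Ltac C_ring := match goal with |- ?a = ?b => change (@eq C a b) end; ring.

Definition hermite_coef (n j : nat) : R :=
  (INR (fact n) / (INR (fact (n - 2 * j)) * INR (fact j)) * / (-4) ^ j)%R.

(** The guard makes the terms with [2 * j > n] vanish; there the truncated [n - 2 * j] would be [0]
    and leave a spurious constant. Sums for neighbouring degrees can thus be taken over a common
    range. *)
Definition hermite_term (n : nat) (x : C) (j : nat) : C :=
  if Nat.leb (2 * j) n then RtoC (hermite_coef n j) * x ^ (n - 2 * j) else 0.

Lemma hermite_sum_term (n N : nat) (x : C) :
  (n / 2 <= N)%nat -> hermite n x = sum_n (hermite_term n x) N.
Proof.
  intros H; induction H as [|N HN IH].
  - unfold hermite; apply sum_n_ext_loc; intros j Hj.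
    unfold hermite_term, hermite_coef.
    pose proof (Nat.Div0.mul_div_le n 2).
    rewrite (proj2 (Nat.leb_le _ _)) by lia.
    rewrite (RtoC_mult _ (/ _)), RtoC_inv, RtoC_pow by (apply pow_nonzero; lra).
    C_ring.
  - rewrite sum_Sn, <- IH; unfold hermite_term.
    pose proof (Nat.div_mod_eq n 2); pose proof (Nat.mod_upper_bound n 2).
    rewrite (proj2 (Nat.leb_gt _ _)) by lia.
    symmetry; apply Cplus_0_r.
Qed.

Lemma INR_fact_S (n : nat) : INR (fact (S n)) = ((INR n + 1) * INR (fact n))%R.
Proof. rewrite fact_simpl, mult_INR, S_INR; ring. Qed.

Lemma hermite_term_SS (n j : nat) (x : C) :
  hermite_term (S (S n)) x (S j) =
  x * hermite_term (S n) x (S j) - RtoC (INR (S n) / 2) * hermite_term n x j.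
Proof.
  assert (P4 : forall j, ((-4) ^ j <> 0)%R) by (intros; apply pow_nonzero; lra).
  pose proof (INR_fact_neq_0) as F0.
  unfold hermite_term.
  destruct (le_lt_dec (2 * j) n) as [H|H].
  2: { rewrite !(proj2 (Nat.leb_gt _ _)) by lia; ring. }
  rewrite (proj2 (Nat.leb_le (2 * j) n)) by lia.
  rewrite (proj2 (Nat.leb_le (2 * S j) (S (S n)))) by lia.
  replace (S (S n) - 2 * S j)%nat with (n - 2 * j)%nat by lia.
  destruct (le_lt_dec n (2 * j)) as [H1|H1].
  (* Here [n = 2 * j]: the term of degree [n + 1] is cut off by the guard, and only the last term of
     [hermite n] contributes. *)
  - rewrite (proj2 (Nat.leb_gt _ _)) by lia.
    replace (n - 2 * j)%nat with O by lia.
    assert (E : hermite_coef (S (S n)) (S j) = (- (INR (S n) / 2 * hermite_coef n j))%R).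
    { unfold hermite_coef.
      replace (S (S n) - 2 * S j)%nat with (n - 2 * j)%nat by lia.
      rewrite !INR_fact_S, !S_INR.
      assert (En : INR n = (2 * INR j)%R) by (replace n with (2 * j)%nat by lia; now rewrite mult_INR).
      rewrite En; simpl pow; field; repeat split; auto.
      pose proof (pos_INR j); lra. }
    rewrite E, RtoC_opp, RtoC_mult; simpl; ring.
  - rewrite (proj2 (Nat.leb_le (2 * S j) (S n))) by lia.
    destruct (n - 2 * j)%nat as [|k] eqn:Ek; [lia |].
    replace (S n - 2 * S j)%nat with k by lia.
    assert (E : hermite_coef (S (S n)) (S j) =
      (hermite_coef (S n) (S j) - INR (S n) / 2 * hermite_coef n j)%R).
    { unfold hermite_coef.
      replace (S (S n) - 2 * S j)%nat with (S k) by lia.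
      replace (S n - 2 * S j)%nat with k by lia.
      rewrite Ek, !INR_fact_S, !S_INR.
      assert (En : INR n = (2 * INR j + INR k + 1)%R).
      { replace n with (2 * j + S k)%nat by lia; rewrite plus_INR, mult_INR, (S_INR k); simpl; ring. }
      rewrite En; simpl pow; field; repeat split; auto;
        pose proof (pos_INR j); pose proof (pos_INR k); lra. }
    rewrite E, RtoC_minus, RtoC_mult; simpl; ring.
Qed.

Lemma sum_Sn_C (a : nat -> C) (n : nat) : sum_n a (S n) = sum_n a n + a (S n).
Proof. exact (sum_Sn a n). Qed.

Lemma hermite_term_0 (n : nat) (x : C) : hermite_term n x 0 = x ^ n.
Proof.
  unfold hermite_term, hermite_coef; rewrite Nat.mul_0_r, Nat.sub_0_r; simpl Nat.leb; cbv iota.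
  replace (INR (fact n) / (INR (fact n) * INR (fact 0)) * / (-4) ^ 0)%R with 1%R; [ring |].
  change (INR (fact 0)) with 1%R; simpl pow; field; apply INR_fact_neq_0.
Qed.

Lemma hermite_SS (n : nat) (x : C) :
  hermite (S (S n)) x = x * hermite (S n) x - RtoC (INR (S n) / 2) * hermite n x.
Proof.
  (* The sum for [n] is one term shorter because [hermite_term_SS] shifts its index; the unmatched
     [j = 0] terms are the leading powers of [x]. *)
  assert (S0 : forall N, sum_n (hermite_term (S (S n)) x) (S N) =
    x * sum_n (hermite_term (S n) x) (S N)
    - RtoC (INR (S n) / 2) * sum_n (hermite_term n x) N).
  { induction N as [|N IH].
    - rewrite !sum_Sn_C, !sum_O, hermite_term_SS.
      rewrite !(hermite_term_0 (S _)).
      change (x ^ S (S n)) with (x * x ^ S n); C_ring.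
    - rewrite sum_Sn_C, IH, hermite_term_SS.
      rewrite (sum_Sn_C (hermite_term (S n) x) (S N)), (sum_Sn_C (hermite_term n x) N); C_ring. }
  assert (D : forall m, (m / 2 <= m)%nat) by (intros; apply Nat.Div0.div_le_upper_bound; lia).
  rewrite (hermite_sum_term (S (S n)) (S (S n))), (hermite_sum_term (S n) (S (S n))),
    (hermite_sum_term n (S n)).
  - apply S0.
  - pose proof (D n); lia.
  - pose proof (D (S n)); lia.
  - apply D.
Qed.

Lemma hermite_0 (x : C) : hermite 0 x = 1.
Proof.
  unfold hermite; simpl Nat.div; rewrite sum_O; simpl.
  replace (1 / (1 * 1))%R with 1%R by field; rewrite !Cmult_1_l; field.
Qed.

Lemma hermite_1 (x : C) : hermite 1 x = x.
Proof.
  unfold hermite; simpl Nat.div; rewrite sum_O; simpl.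
  replace (1 / (1 * 1))%R with 1%R by field; rewrite !Cmult_1_l; field.
Qed.

(** The derivative of [hermite n] in the form in which it occurs in [hhat]; that it is the
    derivative is the content of [path_primitive_hermite]. *)
Definition dhermite (n : nat) (x : C) : C := INR n * hermite (n - 1) x.

Lemma dhermite_S (n : nat) (x : C) : dhermite (S n) x = RtoC (INR n + 1) * hermite n x.
Proof.
  unfold dhermite; rewrite S_INR; simpl Nat.sub; now rewrite Nat.sub_0_r.
Qed.

Lemma dhermite_SS (n : nat) (x : C) :
  dhermite (S (S n)) x =
  hermite (S n) x + x * dhermite (S n) x - RtoC (INR (S n) / 2) * dhermite n x.
Proof.
  rewrite !dhermite_S.
  destruct n as [|n].
  - unfold dhermite; rewrite hermite_0, hermite_1; simpl INR.
    rewrite !RtoC_plus; ring.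
  - rewrite (hermite_SS n), dhermite_S.
    replace (INR (S (S n)) / 2)%R with ((INR n + 2) / 2)%R by (rewrite !S_INR; field).
    rewrite !S_INR.
    rewrite !RtoC_div, !RtoC_plus by lra.
    field.
Qed.

(** The second derivative as prescribed by the Hermite equation; [ddhermite_S] matches it with the
    derivative of [dhermite], and that is where the equation gets proved. *)
Definition ddhermite (n : nat) (x : C) : C :=
  2 * x * dhermite n x - 2 * INR n * hermite n x.

Lemma ddhermite_S (n : nat) (x : C) :
  ddhermite (S n) x = RtoC (INR n + 1) * dhermite n x.
Proof.
  unfold ddhermite; rewrite dhermite_S, S_INR.
  destruct n as [|n].
  - unfold dhermite; rewrite hermite_0, hermite_1; simpl INR.
    rewrite !RtoC_plus; ring.
  - rewrite hermite_SS, dhermite_S, !S_INR.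
    rewrite !RtoC_div, !RtoC_plus by lra.
    field.
Qed.

(** * Primitives along a path *)

Lemma path_primitive_ext (g : R -> C) (f1 f2 P1 P2 : C -> C) :
  (forall t, f1 (g t) = f2 (g t)) -> (forall t, P1 (g t) = P2 (g t)) ->
  path_primitive g f1 P1 -> path_primitive g f2 P2.
Proof.
  intros Ef EP [H1 H2]; split.
  - intros t; now apply path_continuous_ext with (fun s => P1 (g s)).
  - intros t d Hd; rewrite <- Ef.
    apply is_path_derive_ext with (fun s => P1 (g s)); auto.
Qed.

Lemma path_primitive_const (g : R -> C) (c : C) :
  path_primitive g (fun _ => 0) (fun _ => c).
Proof.
  split.
  - intros; apply path_continuous_const.
  - intros t d _; apply is_path_derive_eq with (RtoC 0); [ring | apply is_path_derive_const].
Qed.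

Lemma path_primitive_id (g : R -> C) :
  (forall t, path_continuous g t) -> path_primitive g (fun _ => 1) (fun z => z).
Proof.
  intros Hg; split; auto.
  intros t d H; apply is_path_derive_eq with d; [ring | exact H].
Qed.

Lemma path_primitive_plus (g : R -> C) (f1 f2 P1 P2 : C -> C) :
  path_primitive g f1 P1 -> path_primitive g f2 P2 ->
  path_primitive g (fun z => f1 z + f2 z) (fun z => P1 z + P2 z).
Proof.
  intros [H1 H2] [H3 H4]; split.
  - intros t; now apply path_continuous_plus.
  - intros t d Hd; eapply is_path_derive_eq; [| exact (is_path_derive_plus _ _ _ _ _ (H2 t d Hd) (H4 t d Hd))]; ring.
Qed.

Lemma path_primitive_mult (g : R -> C) (f1 f2 P1 P2 : C -> C) :
  path_primitive g f1 P1 -> path_primitive g f2 P2 ->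
  path_primitive g (fun z => f1 z * P2 z + P1 z * f2 z) (fun z => P1 z * P2 z).
Proof.
  intros [H1 H2] [H3 H4]; split.
  - intros t; now apply path_continuous_mult.
  - intros t d Hd; eapply is_path_derive_eq; [| exact (is_path_derive_mult _ _ _ _ _ (H2 t d Hd) (H4 t d Hd))]; simpl; ring.
Qed.

Lemma path_primitive_scal (g : R -> C) (c : C) (f P : C -> C) :
  path_primitive g f P -> path_primitive g (fun z => c * f z) (fun z => c * P z).
Proof.
  intros H; eapply path_primitive_ext;
    [| | exact (path_primitive_mult g _ _ _ _ (path_primitive_const g c) H)];
    intros; simpl; ring.
Qed.

Lemma path_primitive_inv (g : R -> C) (f P : C -> C) :
  (forall t, P (g t) <> 0) -> path_primitive g f P ->
  path_primitive g (fun z => - (f z / (P z * P z))) (fun z => / P z).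
Proof.
  intros Hn [H1 H2]; split.
  - intros t; now apply path_continuous_inv.
  - intros t d Hd; eapply is_path_derive_eq;
      [| exact (is_path_derive_inv _ _ _ (H2 t d Hd) (Hn t))].
    simpl; field; apply Hn.
Qed.

Lemma path_primitive_Cexp (g : R -> C) (f P : C -> C) :
  path_primitive g f P ->
  path_primitive g (fun z => Cexp (P z) * f z) (fun z => Cexp (P z)).
Proof.
  intros [H1 H2]; split.
  - intros t; now apply path_continuous_Cexp.
  - intros t d Hd; eapply is_path_derive_eq; [| exact (is_path_derive_Cexp _ _ _ (H2 t d Hd))]; simpl; ring.
Qed.

Lemma path_primitive_gaussian (g : R -> C) :
  (forall t, path_continuous g t) ->
  path_primitive g (fun z => - (2 * z) * Cexp (- z ^ 2)) (fun z => Cexp (- z ^ 2)).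
Proof.
  intros Hg; pose proof (path_primitive_id g Hg) as I.
  pose proof (path_primitive_Cexp g _ _
    (path_primitive_scal g (- (1)) _ _ (path_primitive_mult g _ _ _ _ I I))) as H.
  eapply path_primitive_ext; [| | exact H]; intros t; simpl.
  - replace (- (1) * (g t * g t)) with (- (g t * (g t * 1))) by ring; ring.
  - f_equal; ring.
Qed.

(** Two consecutive degrees are carried through the induction: [hermite_SS] builds the next
    polynomial from them, and [dhermite_SS] is that recurrence differentiated. *)
Lemma path_primitive_hermite (g : R -> C) (n : nat) :
  (forall t, path_continuous g t) -> path_primitive g (dhermite n) (hermite n).
Proof.
  intros Hg.
  enough (H : path_primitive g (dhermite n) (hermite n) /\
              path_primitive g (dhermite (S n)) (hermite (S n))) by apply H.
  induction n as [|n [IH0 IH1]]; split; auto.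
  - eapply path_primitive_ext; [| | exact (path_primitive_const g 1)]; intros t.
    + unfold dhermite; simpl INR; ring.
    + now rewrite hermite_0.
  - eapply path_primitive_ext; [| | exact (path_primitive_id g Hg)]; intros t.
    + rewrite dhermite_S, hermite_0; simpl INR; rewrite Rplus_0_l; ring.
    + now rewrite hermite_1.
  - pose proof (path_primitive_plus g _ _ _ _
      (path_primitive_mult g _ _ _ _ (path_primitive_id g Hg) IH1)
      (path_primitive_scal g (- RtoC (INR (S n) / 2)) _ _ IH0)) as H.
    eapply path_primitive_ext; [| | exact H]; intros t.
    + rewrite dhermite_SS; ring.
    + rewrite hermite_SS; ring.
Qed.

Lemma path_primitive_dhermite (g : R -> C) (n : nat) :
  (forall t, path_continuous g t) -> path_primitive g (ddhermite n) (dhermite n).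
Proof.
  intros Hg; destruct n as [|n].
  - eapply path_primitive_ext; [| | exact (path_primitive_const g 0)]; intros t;
      unfold ddhermite, dhermite; simpl INR; ring.
  - eapply path_primitive_ext;
      [| | exact (path_primitive_scal g (RtoC (INR n + 1)) _ _ (path_primitive_hermite g n Hg))];
      intros t.
    + now rewrite ddhermite_S.
    + now rewrite dhermite_S.
Qed.

(** * Decay at the ends of the contour *)

Lemma exp_INR_mult (n : nat) (u : R) : (exp (INR n * u) = exp u ^ n)%R.
Proof.
  induction n as [|n IH]; [now rewrite Rmult_0_l, exp_0 |].
  rewrite S_INR, Rmult_plus_distr_r, exp_plus, IH, Rmult_1_l; simpl; ring.
Qed.

(** With [m = k + 1] and [u = r^2 / (2 m)], the inequality [exp u >= u] raised to the power [m]
    gives [exp (r^2 / 2) >= r^(2 m) / (2 m)^m]; for [r >= 1] the surplus powers of [r] are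
    discarded. *)
Lemma pow_mult_exp_opp_bound (k : nat) (r : R) :
  (1 <= r)%R ->
  (r ^ k * exp (- (r ^ 2 / 2)) <= (2 * INR (S k)) ^ S k / r)%R.
Proof.
  intros Hr.
  assert (Hm : (0 < INR (S k))%R) by (apply lt_0_INR; lia).
  set (m := INR (S k)) in *; set (u := (r ^ 2 / (2 * m))%R).
  assert (Hu : (0 <= u)%R).
  { unfold u; apply Rmult_le_pos; [nra |]; left; apply Rinv_0_lt_compat; lra. }
  assert (E : exp (r ^ 2 / 2) = (exp u ^ S k)%R).
  { rewrite <- exp_INR_mult; fold m; f_equal; unfold u; field; lra. }
  assert (L : (u ^ S k <= exp u ^ S k)%R).
  { apply pow_incr; split; auto; pose proof (exp_ineq1_le u); lra. }
  assert (P : (1 <= r ^ S k)%R) by (apply pow_R1_Rle; lra).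
  assert (Q : (r ^ k * r <= (2 * m) ^ S k * u ^ S k)%R).
  { rewrite <- Rpow_mult_distr.
    replace (2 * m * u)%R with (r * r)%R by (unfold u; field; lra).
    rewrite Rpow_mult_distr; replace (r ^ k * r)%R with (r ^ S k)%R by (simpl; ring); nra. }
  assert (M : (0 < (2 * m) ^ S k)%R) by (apply pow_lt; lra).
  rewrite exp_Ropp, E.
  assert (X : (0 < exp u ^ S k)%R) by apply pow_lt, exp_pos.
  apply Rmult_le_reg_r with (exp u ^ S k)%R; auto.
  rewrite Rmult_assoc, Rinv_l, Rmult_1_r by lra.
  apply Rmult_le_reg_r with r; [lra |].
  replace ((2 * m) ^ S k / r * exp u ^ S k * r)%R with ((2 * m) ^ S k * exp u ^ S k)%R
    by (field; lra).
  nra.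
Qed.

(** One condition for both ends. Slope at most [1 / 2] yields [Re^2 - Im^2 >= |z|^2 / 2], hence
    Gaussian decay in the modulus. *)
Definition to_real_infinity (F : (R -> Prop) -> Prop) (g : R -> C) : Prop :=
  (forall M : R, F (fun t => M < Cmod (g t))%R) /\
  F (fun t => Rabs (Im (g t)) <= Rabs (Re (g t)) / 2)%R.

Definition rapid_decay (F : (R -> Prop) -> Prop) (g h : R -> C) : Prop :=
  forall k : nat, filterlim (fun t => Cmod (g t) ^ k * Cmod (h t))%R F (locally 0%R).

Lemma filterlim_0_squeeze (F : (R -> Prop) -> Prop) {FF : Filter F} (u v : R -> R) :
  F (fun t => 0 <= u t <= v t)%R -> filterlim v F (locally 0%R) ->
  filterlim u F (locally 0%R).
Proof.
  intros H Hv.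
  apply (filterlim_le_le (F := F) (fun _ => 0%R) u v (Finite 0)); auto.
  apply filterlim_const.
Qed.

Lemma filterlim_dist_squeeze (F : (R -> Prop) -> Prop) {FF : Filter F} (u v : R -> R) (c : R) :
  F (fun t => Rabs (u t - c) <= v t)%R -> filterlim v F (locally 0%R) ->
  filterlim u F (locally c).
Proof.
  intros Hu Hv; apply filterlim_locally; intros eps.
  pose proof (proj1 (filterlim_locally _ _) Hv eps) as He.
  generalize (filter_and _ _ Hu He); apply filter_imp; intros t [H1 H2].
  change (Rabs (v t - 0) < eps)%R in H2; change (Rabs (u t - c) < eps)%R.
  rewrite Rminus_0_r in H2; pose proof (Rle_abs (v t)); lra.
Qed.

Lemma pow_Cmod_pos (k : nat) (z : C) : (0 <= Cmod z ^ k)%R.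
Proof. apply pow_le, Cmod_ge_0. Qed.

Lemma rapid_decay_ext (F : (R -> Prop) -> Prop) {FF : Filter F} (g h1 h2 : R -> C) :
  (forall t, h1 t = h2 t) -> rapid_decay F g h1 -> rapid_decay F g h2.
Proof.
  intros E H k; apply filterlim_ext with (2 := H k); intros t; now rewrite E.
Qed.

Lemma rapid_decay_le (F : (R -> Prop) -> Prop) {FF : Filter F} (g h1 h2 : R -> C) (M : R) :
  F (fun t => Cmod (h2 t) <= M * Cmod (h1 t))%R ->
  rapid_decay F g h1 -> rapid_decay F g h2.
Proof.
  intros E H k.
  apply (filterlim_0_squeeze F _ (fun t => M * (Cmod (g t) ^ k * Cmod (h1 t)))%R).
  - revert E; apply filter_imp; intros t Ht.
    pose proof (pow_Cmod_pos k (g t)); pose proof (Cmod_ge_0 (h2 t)); split; nra.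
  - replace 0%R with (M * 0)%R by ring.
    exact (filterlim_comp _ _ _ _ _ _ _ _ (H k)
             (filterlim_scal_r (V := R_NormedModule) M 0%R)).
Qed.

Lemma rapid_decay_plus (F : (R -> Prop) -> Prop) {FF : Filter F} (g h1 h2 : R -> C) :
  rapid_decay F g h1 -> rapid_decay F g h2 -> rapid_decay F g (fun t => h1 t + h2 t).
Proof.
  intros H1 H2 k.
  apply (filterlim_0_squeeze F _
    (fun t => Cmod (g t) ^ k * Cmod (h1 t) + Cmod (g t) ^ k * Cmod (h2 t))%R).
  - apply filter_forall; intros t.
    pose proof (pow_Cmod_pos k (g t)); pose proof (Cmod_triangle (h1 t) (h2 t)).
    pose proof (Cmod_ge_0 (h1 t + h2 t)); split; nra.
  - replace 0%R with (0 + 0)%R by ring.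
    exact (filterlim_comp_2 _ _ Rplus (H1 k) (H2 k) (filterlim_plus (V := R_NormedModule) _ _)).
Qed.

Lemma im_le_Cmod (z : C) : (Rabs (Im z) <= Cmod z)%R.
Proof.
  eapply Rle_trans; [apply (Rmax_r (Rabs (fst z)) (Rabs (snd z))) | apply Rmax_Cmod].
Qed.

Lemma rapid_decay_tends (F : (R -> Prop) -> Prop) {FF : Filter F} (g h : R -> C) :
  rapid_decay F g h -> Ctends F h 0.
Proof.
  intros H; specialize (H O); simpl in H.
  assert (H' : filterlim (fun t => Cmod (h t)) F (locally 0%R)).
  { apply filterlim_ext with (2 := H); intros; ring. }
  split; refine (filterlim_dist_squeeze F _ _ _ _ H'); apply filter_forall; intros t.
  - change (Re 0) with 0%R; rewrite Rminus_0_r; apply re_le_Cmod.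
  - change (Im 0) with 0%R; rewrite Rminus_0_r; apply im_le_Cmod.
Qed.

Lemma Cmod_Cexp_opp_sqr (z : C) :
  Cmod (Cexp (- z ^ 2)) = exp (Im z ^ 2 - Re z ^ 2).
Proof.
  rewrite Cexp_opp_sqr; unfold Cmod, egauss_cos, egauss_sin; simpl fst; simpl snd.
  set (e := exp _); set (a := (2 * Re z * Im z)%R).
  replace ((e * cos a) ^ 2 + (- (e * sin a)) ^ 2)%R with (e ^ 2)%R.
  - rewrite sqrt_pow2; auto; left; apply exp_pos.
  - pose proof (sin2_cos2 a) as S; unfold Rsqr in S; simpl; nra.
Qed.

Lemma rapid_decay_gaussian (F : (R -> Prop) -> Prop) {FF : Filter F} (g : R -> C) :
  to_real_infinity F g -> rapid_decay F g (fun t => Cexp (- g t ^ 2)).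
Proof.
  intros [H1 H2] k; apply filterlim_locally; intros eps.
  set (A := ((2 * INR (S k)) ^ S k)%R).
  assert (HA : (0 < A)%R).
  { apply pow_lt; pose proof (lt_0_INR (S k) ltac:(lia)); lra. }
  (* Beyond modulus [1] the quantity is at most [A / |z|], and beyond [A / eps] this is below
     [eps]. *)
  generalize (filter_and _ _ (filter_and _ _ (H1 1%R) (H1 (A / eps)%R)) H2).
  apply filter_imp; intros t [[Ht1 Ht2] Ht3].
  unfold ball; simpl; unfold AbsRing_ball, abs, minus, plus, opp; simpl.
  change (g t * (g t * 1)) with (g t ^ 2).
  rewrite Ropp_0, Rplus_0_r, Cmod_Cexp_opp_sqr.
  pose proof (pow_Cmod_pos k (g t)); pose proof (exp_pos (Im (g t) ^ 2 - Re (g t) ^ 2)).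
  rewrite Rabs_right by (apply Rle_ge, Rmult_le_pos; lra).
  pose proof (pow_mult_exp_opp_bound k (Cmod (g t)) ltac:(lra)) as B; fold A in B.
  assert (R2 : (Cmod (g t) ^ 2 = Re (g t) ^ 2 + Im (g t) ^ 2)%R).
  { unfold Cmod; rewrite pow2_sqrt; [reflexivity | unfold Re, Im; simpl; nra]. }
  assert (Q : (Im (g t) ^ 2 <= Re (g t) ^ 2 / 4)%R).
  { rewrite <- (pow2_abs (Im (g t))), <- (pow2_abs (Re (g t))).
    pose proof (Rabs_pos (Im (g t))); nra. }
  assert (L : (exp (Im (g t) ^ 2 - Re (g t) ^ 2) <= exp (- (Cmod (g t) ^ 2 / 2)))%R).
  { apply exp_le_mono; rewrite R2.
    pose proof (pow2_ge_0 (Re (g t))); lra. }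
  apply Rle_lt_trans with (A / Cmod (g t))%R; [nra |].
  pose proof (cond_pos eps).
  apply Rmult_lt_reg_r with (Cmod (g t)); [lra |].
  unfold Rdiv; rewrite Rmult_assoc, Rinv_l, Rmult_1_r by lra.
  apply Rmult_lt_reg_r with (/ eps)%R; [now apply Rinv_0_lt_compat |].
  replace (eps * Cmod (g t) * / eps)%R with (Cmod (g t)) by (field; lra); exact Ht2.
Qed.

(** Multipliers of rapidly decaying functions. They are closed under sums and products, so no
    degrees need to be tracked, and they include [1 / (z + b)] besides the polynomials. *)
Definition tame (F : (R -> Prop) -> Prop) (g : R -> C) (p : C -> C) : Prop :=
  forall h, rapid_decay F g h -> rapid_decay F g (fun t => p (g t) * h t).

Lemma tame_const (F : (R -> Prop) -> Prop) {FF : Filter F} (g : R -> C) (c : C) :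
  tame F g (fun _ => c).
Proof.
  intros h; apply rapid_decay_le with (Cmod c); auto.
  apply filter_forall; intros t; rewrite Cmod_mult; lra.
Qed.

Lemma tame_id (F : (R -> Prop) -> Prop) {FF : Filter F} (g : R -> C) :
  tame F g (fun z => z).
Proof.
  intros h H k; apply filterlim_ext with (2 := H (S k)).
  intros t; rewrite Cmod_mult; simpl; ring.
Qed.

Lemma tame_plus (F : (R -> Prop) -> Prop) {FF : Filter F} (g : R -> C) (p q : C -> C) :
  tame F g p -> tame F g q -> tame F g (fun z => p z + q z).
Proof.
  intros Hp Hq h H.
  apply rapid_decay_ext with (fun t => p (g t) * h t + q (g t) * h t); auto.
  - intros; ring.
  - apply rapid_decay_plus; auto.
Qed.

Lemma tame_mult (F : (R -> Prop) -> Prop) {FF : Filter F} (g : R -> C) (p q : C -> C) :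
  tame F g p -> tame F g q -> tame F g (fun z => p z * q z).
Proof.
  intros Hp Hq h H.
  apply rapid_decay_ext with (fun t => p (g t) * (q (g t) * h t)); auto.
  intros; ring.
Qed.

Lemma tame_ext (F : (R -> Prop) -> Prop) {FF : Filter F} (g : R -> C) (p q : C -> C) :
  (forall z, p z = q z) -> tame F g p -> tame F g q.
Proof.
  intros E Hp h H; apply rapid_decay_ext with (fun t => p (g t) * h t); auto.
  intros; now rewrite E.
Qed.

(** Once [|z| > 1 + |b|], the triangle inequality gives [|z + b| >= 1], so the factor does not
    enlarge anything near the ends. *)
Lemma tame_inv_shift (F : (R -> Prop) -> Prop) {FF : Filter F} (g : R -> C) (b : C) :
  to_real_infinity F g -> tame F g (fun z => / (z + b)).
Proof.
  intros [H1 _] h; apply rapid_decay_le with 1%R; auto.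
  generalize (H1 (1 + Cmod b)%R); apply filter_imp; intros t Ht.
  assert (L : (1 <= Cmod (g t + b))%R).
  { pose proof (Cmod_triangle (g t + b) (- b)) as T.
    replace (g t + b + - b) with (g t) in T by ring.
    rewrite Cmod_opp in T; lra. }
  assert (N : g t + b <> 0).
  { intros E; rewrite E, Cmod_0 in L; lra. }
  rewrite Cmod_mult, Cmod_inv by exact N.
  pose proof (Cmod_ge_0 (h t)).
  apply Rmult_le_compat_r; auto.
  rewrite <- Rinv_1; apply Rinv_le_contravar; lra.
Qed.

Lemma tame_hermite (F : (R -> Prop) -> Prop) {FF : Filter F} (g : R -> C) (n : nat) :
  tame F g (hermite n).
Proof.
  enough (H : tame F g (hermite n) /\ tame F g (hermite (S n))) by apply H.
  induction n as [|n [IH0 IH1]]; split; auto.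
  - apply tame_ext with (fun _ => RtoC 1); auto; [intros; now rewrite hermite_0 |].
    now apply tame_const.
  - apply tame_ext with (fun z => z); auto; [intros; now rewrite hermite_1 |].
    now apply tame_id.
  - apply tame_ext with (fun z => z * hermite (S n) z + - RtoC (INR (S n) / 2) * hermite n z); auto.
    + intros z; rewrite hermite_SS; ring.
    + apply tame_plus; auto; apply tame_mult; auto; [now apply tame_id | now apply tame_const].
Qed.

Lemma tame_dhermite (F : (R -> Prop) -> Prop) {FF : Filter F} (g : R -> C) (n : nat) :
  tame F g (dhermite n).
Proof. apply tame_mult; auto; [now apply tame_const | now apply tame_hermite]. Qed.

Lemma contour_ends_to_real_infinity (g : R -> C) :
  contour_minfty_pinfty g ->
  to_real_infinity (Rbar_locally m_infty) g /\
  to_real_infinity (Rbar_locally p_infty) g.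
Proof.
  (* A nonzero real part makes the slope a true quotient; at [x = 0] the default value of the
     division would say nothing about [y]. *)
  assert (Q : forall x y : R, (Rabs x > 0)%R -> (Rabs (y / x) < 1 / 2)%R ->
    (Rabs y <= Rabs x / 2)%R).
  { intros x y Hx H; unfold Rdiv in H.
    assert (x <> 0)%R by (intros ->; rewrite Rabs_R0 in Hx; lra).
    rewrite Rabs_mult, Rabs_inv in H.
    apply Rmult_lt_compat_r with (r := Rabs x) in H; auto.
    rewrite Rmult_assoc, Rinv_l in H by lra; lra. }
  assert (L : locally 0%R (fun y => Rabs y < 1 / 2)%R).
  { exists (mkposreal (1 / 2) ltac:(lra)); intros y Hy.
    change (Rabs (y - 0) < 1 / 2)%R in Hy; now rewrite Rminus_0_r in Hy. }
  intros [_ [Rm [Im_ [Rp Ip]]]]; split; split.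
  - intros M.
    assert (S : Rbar_locally m_infty (fun y => y < - Rabs M)%R) by now exists (- Rabs M)%R.
    generalize (Rm _ S); unfold filtermap; simpl; apply (filter_imp (F := Rbar_locally m_infty)).
    intros t Ht; pose proof (re_le_Cmod (g t)); pose proof (Rle_abs M).
    pose proof (Rle_abs (- Re (g t))) as A; rewrite Rabs_Ropp in A; lra.
  - assert (S : Rbar_locally m_infty (fun y => y < 0)%R) by now exists 0%R.
    generalize (filter_and (F := Rbar_locally m_infty) _ _ (Rm _ S) (Im_ _ L)).
    apply (filter_imp (F := Rbar_locally m_infty)); intros t [H1 H2]; apply Q; auto.
    rewrite Rabs_left; lra.
  - intros M.
    assert (S : Rbar_locally p_infty (fun y => Rabs M < y)%R) by now exists (Rabs M)%R.
    generalize (Rp _ S); unfold filtermap; simpl; apply (filter_imp (F := Rbar_locally p_infty)).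
    intros t Ht; pose proof (re_le_Cmod (g t)); pose proof (Rle_abs M).
    pose proof (Rle_abs (Re (g t))); lra.
  - assert (S : Rbar_locally p_infty (fun y => 0 < y)%R) by now exists 0%R.
    generalize (filter_and (F := Rbar_locally p_infty) _ _ (Rp _ S) (Ip _ L)).
    apply (filter_imp (F := Rbar_locally p_infty)); intros t [H1 H2]; apply Q; auto.
    rewrite Rabs_right; lra.
Qed.

Lemma cgauss_tends (F : (R -> Prop) -> Prop) {FF : Filter F} (g : R -> C) (c : R) :
  to_real_infinity F g ->
  F (fun t => Rabs (cgauss_re (Re (g t)) (Im (g t)) - c) <=
              (2 + Rabs (Im (g t))) * exp (Im (g t) ^ 2 - Re (g t) ^ 2))%R ->
  Ctends F (fun t => cgauss (g t)) c.
Proof.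
  intros H HB.
  pose proof (rapid_decay_gaussian F g H) as W.
  (* The bound [(2 + |Im z|) |exp (- z^2)|] is dominated by the powers [k = 0] and [k = 1] of rapid
     decay; it also covers the imaginary part. *)
  assert (V : filterlim (fun t => 2 * (Cmod (g t) ^ 0 * Cmod (Cexp (- g t ^ 2)))
                + Cmod (g t) ^ 1 * Cmod (Cexp (- g t ^ 2)))%R F (locally 0%R)).
  { replace 0%R with (2 * 0 + 0)%R by ring.
    refine (filterlim_comp_2 _ _ Rplus _ (W 1%nat) (filterlim_plus (V := R_NormedModule) _ _)).
    exact (filterlim_comp _ _ _ _ _ _ _ _ (W 0%nat)
             (filterlim_scal_r (V := R_NormedModule) 2%R 0%R)). }
  split; refine (filterlim_dist_squeeze F _ _ _ _ V).
  - revert HB; apply filter_imp; intros t Ht; eapply Rle_trans; [exact Ht |].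
    rewrite Cmod_Cexp_opp_sqr; pose proof (im_le_Cmod (g t)).
    pose proof (exp_pos (Im (g t) ^ 2 - Re (g t) ^ 2)); simpl in *; nra.
  - apply filter_forall; intros t; change (Im c) with 0%R; rewrite Rminus_0_r.
    eapply Rle_trans; [apply cgauss_im_bound |].
    rewrite Cmod_Cexp_opp_sqr; pose proof (im_le_Cmod (g t)).
    pose proof (exp_pos (Im (g t) ^ 2 - Re (g t) ^ 2)); simpl in *; nra.
Qed.

(** * Values of contour integrals *)

Definition gaussian (z : C) : C := Cexp (- z ^ 2).

(** Carrying a primitive with its limits makes values linear in [f] without any integrability
    argument; the passage to integrals is made once, at the end. *)
Definition primitive_value (g : R -> C) (f : C -> C) (v : C) : Prop :=
  exists (Phi : C -> C) (lm lp : C),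
    path_primitive g f Phi /\
    Ctends (Rbar_locally m_infty) (fun t => Phi (g t)) lm /\
    Ctends (Rbar_locally p_infty) (fun t => Phi (g t)) lp /\
    lp - lm = v.

Lemma primitive_value_ext (g : R -> C) (f1 f2 : C -> C) (v : C) :
  (forall t, f1 (g t) = f2 (g t)) -> primitive_value g f1 v -> primitive_value g f2 v.
Proof.
  intros E (Phi & lm & lp & H1 & H2); exists Phi, lm, lp; split; auto.
  now apply path_primitive_ext with f1 Phi.
Qed.

Lemma primitive_value_plus (g : R -> C) (f1 f2 : C -> C) (v1 v2 : C) :
  primitive_value g f1 v1 -> primitive_value g f2 v2 ->
  primitive_value g (fun z => f1 z + f2 z) (v1 + v2).
Proof.
  intros (P1 & m1 & p1 & A1 & B1 & C1 & D1) (P2 & m2 & p2 & A2 & B2 & C2 & D2).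
  exists (fun z => P1 z + P2 z), (m1 + m2), (p1 + p2); split; [| split; [| split]].
  - now apply path_primitive_plus.
  - apply (Ctends_plus _ (fun t => P1 (g t)) (fun t => P2 (g t))); auto.
  - apply (Ctends_plus _ (fun t => P1 (g t)) (fun t => P2 (g t))); auto.
  - rewrite <- D1, <- D2; ring.
Qed.

Lemma primitive_value_scal (g : R -> C) (c : C) (f : C -> C) (v : C) :
  primitive_value g f v -> primitive_value g (fun z => c * f z) (c * v).
Proof.
  intros (P & lm & lp & A & B & D & E).
  exists (fun z => c * P z), (c * lm), (c * lp); split; [| split; [| split]].
  - now apply path_primitive_scal.
  - apply (Ctends_mult _ (fun _ => c) (fun t => P (g t))); auto; apply Ctends_const; apply _.
  - apply (Ctends_mult _ (fun _ => c) (fun t => P (g t))); auto; apply Ctends_const; apply _.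
  - rewrite <- E; ring.
Qed.

Definition tame_ends (g : R -> C) (p : C -> C) : Prop :=
  tame (Rbar_locally m_infty) g p /\ tame (Rbar_locally p_infty) g p.

(** The integrand is [(p w)'] for the weight [w = exp (- z^2)], and [p w] vanishes at both ends
    since [p] is tame. *)
Lemma primitive_value_exact (g : R -> C) (p dp : C -> C) :
  contour_minfty_pinfty g ->
  path_primitive g dp p -> tame_ends g p ->
  primitive_value g (fun z => (dp z - 2 * z * p z) * gaussian z) 0.
Proof.
  intros Hg Hp [T1 T2].
  assert (Hc : forall t, path_continuous g t).
  { intros t; apply piecewise_C1_path_continuous, Hg. }
  destruct (contour_ends_to_real_infinity g Hg) as [E1 E2].
  exists (fun z => p z * gaussian z), (RtoC 0), (RtoC 0); split; [| split; [| split]].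
  - eapply path_primitive_ext;
      [| | exact (path_primitive_mult g _ _ _ _ Hp (path_primitive_gaussian g Hc))];
      intros t; unfold gaussian; ring.
  - apply (rapid_decay_tends _ g), T1, rapid_decay_gaussian; auto; apply _.
  - apply (rapid_decay_tends _ g), T2, rapid_decay_gaussian; auto; apply _.
  - ring.
Qed.

Lemma tame_ends_const (g : R -> C) (c : C) : tame_ends g (fun _ => c).
Proof. split; apply tame_const; apply _. Qed.

Lemma tame_ends_plus (g : R -> C) (p q : C -> C) :
  tame_ends g p -> tame_ends g q -> tame_ends g (fun z => p z + q z).
Proof. intros [] []; split; apply tame_plus; auto; apply _. Qed.

Lemma tame_ends_mult (g : R -> C) (p q : C -> C) :
  tame_ends g p -> tame_ends g q -> tame_ends g (fun z => p z * q z).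
Proof. intros [] []; split; apply tame_mult; auto; apply _. Qed.

Lemma tame_ends_hermite (g : R -> C) (n : nat) : tame_ends g (hermite n).
Proof. split; apply tame_hermite; apply _. Qed.

Lemma tame_ends_dhermite (g : R -> C) (n : nat) : tame_ends g (dhermite n).
Proof. split; apply tame_dhermite; apply _. Qed.

Lemma tame_ends_inv_shift (g : R -> C) (b : C) :
  contour_minfty_pinfty g -> tame_ends g (fun z => / (z + b)).
Proof.
  intros H; apply contour_ends_to_real_infinity in H; destruct H.
  split; apply tame_inv_shift; auto; apply _.
Qed.

Lemma primitive_value_gaussian (g : R -> C) :
  contour_minfty_pinfty g -> primitive_value g gaussian (RtoC (sqrt PI)).
Proof.
  intros Hg; destruct (contour_ends_to_real_infinity g Hg) as [E1 E2].
  destruct Hg as [Hp [Rm [_ [Rp _]]]].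
  exists cgauss, (RtoC (- (sqrt PI / 2))), (RtoC (sqrt PI / 2)); split; [| split; [| split]].
  - apply path_primitive_cgauss; intros; now apply piecewise_C1_path_continuous.
  - apply cgauss_tends; [apply _ | exact E1 |].
    assert (S : Rbar_locally m_infty (fun y => y < 0)%R) by now exists 0%R.
    generalize (Rm _ S); apply (filter_imp (F := Rbar_locally m_infty)).
    intros t Ht; apply cgauss_re_bound_neg; lra.
  - apply cgauss_tends; [apply _ | exact E2 |].
    assert (S : Rbar_locally p_infty (fun y => 0 < y)%R) by now exists 0%R.
    generalize (Rp _ S); apply (filter_imp (F := Rbar_locally p_infty)).
    intros t Ht; apply cgauss_re_bound_pos; lra.
  - rewrite <- RtoC_minus; f_equal; field.
Qed.

Lemma primitive_value_hermite_sqr (g : R -> C) (n : nat) :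
  contour_minfty_pinfty g ->
  primitive_value g (fun z => hermite n z * hermite n z * gaussian z)
    (RtoC (sqrt PI) * RtoC (nu n)).
Proof.
  intros Hg.
  assert (Hc : forall t, path_continuous g t).
  { intros t; apply piecewise_C1_path_continuous, Hg. }
  induction n as [|n IH].
  - replace (nu 0) with 1%R by (unfold nu; simpl; field).
    rewrite Cmult_1_r.
    apply primitive_value_ext with gaussian; [| now apply primitive_value_gaussian].
    intros t; rewrite hermite_0; ring.
  - replace (RtoC (sqrt PI) * RtoC (nu (S n)))
      with (RtoC ((INR n + 1) / 2) * (RtoC (sqrt PI) * RtoC (nu n)) + RtoC (- / 2) * 0).
    + eapply primitive_value_ext; [|
        exact (primitive_value_plus g _ _ _ _ (primitive_value_scal g _ _ _ IH)
         (primitive_value_scal g _ _ _ (primitive_value_exact g _ _ Hg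
           (path_primitive_mult g _ _ _ _ (path_primitive_hermite g (S n) Hc)
              (path_primitive_hermite g n Hc))
           (tame_ends_mult g _ _ (tame_ends_hermite g (S n)) (tame_ends_hermite g n)))))].
      intros t; simpl.
      (* The raising relation: in [(h_{n+1} h_n w)'] it turns [h_n' - 2 x h_n] into [- 2 h_{n+1}],
         which produces the square. *)
      assert (E : dhermite n (g t) = 2 * g t * hermite n (g t) - 2 * hermite (S n) (g t)).
      { destruct n as [|k].
        - rewrite hermite_0, hermite_1; unfold dhermite; simpl INR; ring.
        - rewrite hermite_SS, dhermite_S, S_INR, RtoC_div by lra; field. }
      rewrite E, dhermite_S, RtoC_div, RtoC_opp, RtoC_inv by lra.
      field.
    + unfold nu; rewrite INR_fact_S; simpl pow.
      rewrite <- !RtoC_mult, <- RtoC_plus; f_equal; field.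
      apply pow_nonzero; lra.
Qed.

(** In self-adjoint form the Hermite equation reads [(y' w)' = - 2 n y w], so the products [y' z']
    cancel in the derivative of the weighted Wronskian; dividing by [2 m - 2 n] isolates [y z w]. *)
Lemma primitive_value_hermite_neq (g : R -> C) (n m : nat) :
  contour_minfty_pinfty g -> n <> m ->
  primitive_value g (fun z => hermite n z * hermite m z * gaussian z) 0.
Proof.
  intros Hg Hnm.
  assert (Hc : forall t, path_continuous g t).
  { intros t; apply piecewise_C1_path_continuous, Hg. }
  assert (N : RtoC (2 * INR m - 2 * INR n) <> 0).
  { intros Z; apply RtoC_inj in Z; apply Hnm, INR_eq; lra. }
  set (c := / RtoC (2 * INR m - 2 * INR n)).
  replace (RtoC 0) with (c * 0 + - c * 0) by ring.
  eapply primitive_value_ext; [|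
    exact (primitive_value_plus g _ _ _ _
     (primitive_value_scal g _ _ _ (primitive_value_exact g _ _ Hg
       (path_primitive_mult g _ _ _ _ (path_primitive_dhermite g n Hc)
          (path_primitive_hermite g m Hc))
       (tame_ends_mult g _ _ (tame_ends_dhermite g n) (tame_ends_hermite g m))))
     (primitive_value_scal g _ _ _ (primitive_value_exact g _ _ Hg
       (path_primitive_mult g _ _ _ _ (path_primitive_hermite g n Hc)
          (path_primitive_dhermite g m Hc))
       (tame_ends_mult g _ _ (tame_ends_hermite g n) (tame_ends_dhermite g m)))))].
  intros t; unfold c, ddhermite; simpl.
  revert N; rewrite RtoC_minus, !RtoC_mult; intros N; field; exact N.
Qed.

(** * From Hermite polynomials to the exceptional polynomials *)

(** The constant is not symmetric in [m] and [n] because the equation of [hermite m] alone is used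
    to integrate [y' z' w]; this is consistent, as [v] is [0] for [m <> n]. *)
Lemma primitive_value_hhat (b : C) (g : R -> C) (m n : nat) (v : C) :
  contour_minfty_pinfty g -> (forall t, g t + b <> 0) ->
  primitive_value g (fun z => hermite n z * hermite m z * gaussian z) v ->
  primitive_value g (fun z => hhat n b z * hhat m b z * gaussian z)
    (((b ^ 2 - 2 * INR n) * (b ^ 2 - 2 * INR m) + 4 * INR m - 2 * b ^ 2) * v).
Proof.
  intros Hg Hb Hv.
  assert (Hc : forall t, path_continuous g t).
  { intros t; apply piecewise_C1_path_continuous, Hg. }
  pose proof (fun k => path_primitive_plus g _ _ _ _
    (path_primitive_scal g b _ _ (path_primitive_hermite g k Hc))
    (path_primitive_dhermite g k Hc)) as PY.
  pose proof (fun k => tame_ends_plus g _ _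
    (tame_ends_mult g _ _ (tame_ends_const g b) (tame_ends_hermite g k))
    (tame_ends_dhermite g k)) as TY.
  pose proof (path_primitive_inv g _ (fun z => z + b) Hb
    (path_primitive_plus g _ _ _ _ (path_primitive_id g Hc) (path_primitive_const g b))) as PS.
  (* The two zeros are the values of the exact terms, [Y Z w / s] with coefficient [-1] and [y z' w]
     with coefficient [2]. *)
  match goal with |- primitive_value _ _ (?c * v) =>
    replace (c * v) with (c * v + (- RtoC 1 * 0 + 2 * 0)) by ring end.
  eapply primitive_value_ext; [|
    exact (primitive_value_plus g _ _ _ _ (primitive_value_scal g _ _ _ Hv)
     (primitive_value_plus g _ _ _ _
       (primitive_value_scal g _ _ _ (primitive_value_exact g _ _ Hg
         (path_primitive_mult g _ _ _ _
           (path_primitive_mult g _ _ _ _ (PY n) (PY m)) PS)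
         (tame_ends_mult g _ _ (tame_ends_mult g _ _ (TY n) (TY m))
           (tame_ends_inv_shift g b Hg))))
       (primitive_value_scal g _ _ _ (primitive_value_exact g _ _ Hg
         (path_primitive_mult g _ _ _ _ (path_primitive_hermite g n Hc)
           (path_primitive_dhermite g m Hc))
         (tame_ends_mult g _ _ (tame_ends_hermite g n) (tame_ends_dhermite g m))))))].
  intros t; unfold hhat, ddhermite; fold (dhermite n (g t)) (dhermite m (g t)); simpl.
  field; apply Hb.
Qed.

Lemma path_continuous_hhat (b : C) (g : R -> C) (n : nat) (t : R) :
  contour_minfty_pinfty g -> g t + b <> 0 ->
  path_continuous (fun s => hhat n b (g s)) t.
Proof.
  intros Hg Hb.
  assert (Hc : forall t, path_continuous g t).
  { intros s; apply piecewise_C1_path_continuous, Hg. }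
  destruct (path_primitive_hermite g n Hc) as [H _].
  destruct (path_primitive_dhermite g n Hc) as [H' _].
  apply path_continuous_ext with (fun s => (b ^ 2 - 2 * INR n) * hermite n (g s) +
    - RtoC 1 * ((b * hermite n (g s) + dhermite n (g s)) * / (g s + b))).
  { intros s; unfold hhat, dhermite, Cdiv; ring. }
  apply path_continuous_plus.
  - apply path_continuous_mult; [apply path_continuous_const | apply H].
  - apply path_continuous_mult; [apply path_continuous_const |].
    apply path_continuous_mult.
    + apply path_continuous_plus; [| apply H'].
      apply path_continuous_mult; [apply path_continuous_const | apply H].
    + apply path_continuous_inv; auto.
      apply path_continuous_plus; [apply Hc | apply path_continuous_const].
Qed.

Lemma hhat_contour_integral (b : C) (g : R -> C) (m n : nat) :
  contour_minfty_pinfty g -> (forall t, g t + b <> 0) ->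
  is_contour_integral g (fun x => hhat n b x * hhat m b x * Cexp (- x ^ 2))
    (RtoC (sqrt PI) * (kronecker m n * p2 b (- (2 * INR n)) * nu n)).
Proof.
  intros Hg Hb.
  assert (V : primitive_value g (fun z => hhat n b z * hhat m b z * gaussian z)
    (RtoC (sqrt PI) * (kronecker m n * p2 b (- (2 * INR n)) * nu n))).
  { unfold kronecker; destruct (Nat.eqb_spec m n) as [->|Hmn].
    - pose proof (primitive_value_hhat b g n n _ Hg Hb (primitive_value_hermite_sqr g n Hg)) as V.
      match type of V with primitive_value _ _ ?x =>
        match goal with |- primitive_value _ _ ?y => replace y with x; [exact V |] end end.
      unfold p2; ring.
    - pose proof (primitive_value_hhat b g m n _ Hg Hb
        (primitive_value_hermite_neq g n m Hg (not_eq_sym Hmn))) as V.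
      match type of V with primitive_value _ _ ?x =>
        match goal with |- primitive_value _ _ ?y => replace y with x; [exact V |] end end.
      ring. }
  destruct V as (Phi & lm & lp & H1 & H2 & H3 & <-).
  apply is_contour_integral_primitive with Phi; auto; [apply Hg |].
  intros t; apply path_continuous_mult; [apply path_continuous_mult |];
    try (now apply path_continuous_hhat).
  destruct (path_primitive_gaussian g) as [H _]; [| apply H].
  intros s; apply piecewise_C1_path_continuous, Hg.
Qed.

Theorem proposition2p4 (b : C) (g : R -> C)
  (hg : contour_minfty_pinfty g)
  (hb : forall t : R, g t <> - b)
  (m n : nat) :
  (exists I : C,
      is_contour_integral g
        (fun x => htildeS n b x * htildeS m b x
                  * (Cexp (- x ^ 2) / (x + b) ^ 2)) I /\
      1 / RtoC (sqrt PI) * I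
        = kronecker m n * p2 b (- (2 * INR n)) * nu n) /\
  (exists I : C,
      is_contour_integral g
        (fun x => hhat n b x * hhat m b x * Cexp (- x ^ 2)) I /\
      1 / RtoC (sqrt PI) * I
        = kronecker m n * p2 b (- (2 * INR n)) * nu n).
Proof.
  assert (hb' : forall t, g t + b <> 0).
  { intros t E; apply (hb t); replace (g t) with (g t + b + - b) by ring; rewrite E; ring. }
  pose proof (hhat_contour_integral b g m n hg hb') as H.
  assert (S : RtoC (sqrt PI) <> 0).
  { intros E; apply RtoC_inj in E; pose proof (sqrt_lt_R0 PI PI_RGT_0); lra. }
  assert (E : forall v, 1 / RtoC (sqrt PI) * (RtoC (sqrt PI) * v) = v)
    by (intros; field; exact S).
  split; eexists; (split; [| apply E]); [| exact H].
  unfold is_contour_integral in *.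
  (* On the path [x + b] is nonzero, so the two factors [x + b] of the [htildeS] cancel [(x + b)^2]
     and both integrands agree at every parameter. *)
  apply (is_RInt_gen_ext (V := C_R_NormedModule)) with (2 := H).
  apply filter_forall; intros [u v] t _; simpl.
  unfold htildeS; field; apply hb'.
Qed.
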